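(* Let $p$ be an odd prime and $T$ the $p$-adic tree. Let $S\le\operatorname{Aut}T$ be the Sylow pro-$p$ subgroup consisting of all elements whose labels are powers of $a$, the rooted $p$-cycle permuting transitively the first-level vertices. Let $G=\langle a\rangle\ltimes\operatorname{St}_G(1)\le S$ be a self-similar group containing a directed automorphism $b\in\operatorname{St}_S(1)$ such that $$\psi(b)=(a^{e_1},\dots,a^{e_{p-1}},b)\quad\text{with}\quad \sum_{i=1}^{p-1}e_i\not\equiv 0 \pmod p,$$ where $\psi\colon\operatorname{St}_G(1)\to G\times\overset{p}{\cdots}\times G$ denotes the natural embedding. Then, for every $m\in\mathbb{N}$, the normal subgroups $N\trianglelefteq G$ with $\operatorname{St}_G(m+1)\subseteq N\subseteq\operatorname{St}_G(m)$ form a chain $$\operatorname{St}_G(m+1)=N_0\subsetneq N_1\subsetneq\cdots\subsetneq N_{t(m)}=\operatorname{St}_G(m)$$ of length $t(m)=\log_p|\operatorname{St}_G(m):\operatorname{St}_G(m+1)|$, so that $|N_j:N_{j-1}|=p$ for $1\le j\le t(m)$. Furthermore, if $G$ is a multi-EGS group, then the normal subgroups $N_0,N_1,\dots,N_{t(m)}$ are also characteristic in $G$, and $t(m+1)\le p\,t(m)$ for every $m\in\mathbb{N}$. Additionally, if $G=\langle a,b\rangle$ is a (non-torsion) GGS-group and regular branch over $[G,G]$, then $t(1)=p$ and $t(m)=(p-1)p^{m-1}$ for $m\ge2$.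
   Context: **Tree and automorphisms.** $T$ is the infinite rooted tree whose vertices are the finite words over $X=\{1,\dots,p\}$ (root: the empty word), with an edge between $u$ and $ux$ for every word $u$ and $x\in X$; the $n$th level consists of the words of length $n$. $\operatorname{Aut} T$ acts on the right, $u\mapsto u^f$. For $f\in\operatorname{Aut}T$ and a vertex $u$, the label $f(u)\in\operatorname{Sym}(X)$ is given by $(ux)^f=u^fx^{f(u)}$ for $x\in X$, and the section $f_u\in\operatorname{Aut}T$ is given by $(uv)^f=u^fv^{f_u}$ for all words $v$. The rooted automorphism $a$ is defined by $(xv)^a=x^{\sigma}v$ with $\sigma=(1\,2\,\cdots\,p)$; ''labels are powers of $a$'' means that all labels lie in $\langle\sigma\rangle$. For $G\le\operatorname{Aut}T$, $\operatorname{St}_G(n)$ is the subgroup of elements of $G$ fixing all vertices of level $n$, and $\psi$ sends $g\in\operatorname{St}_{\operatorname{Aut}T}(1)$ to the tuple $(g_1,\dots,g_p)$ of its sections at the vertices $1,\dots,p$. $\mathbb{N}$ denotes the positive integers. **Regular branch.** $G$ is self-similar if for every vertex $u$ the sections at $u$ of the elements of $G$ fixing $u$ all lie in $G$. $G$ is regular branch over a finite-index subgroup $K\le G$ if $G$ acts transitively on every level of $T$, $G$ is self-similar, and $K\times\overset{p}{\cdots}\times K\subseteq\psi(\operatorname{St}_G(1)\cap K)$. **Multi-EGS groups.** Let $r_1,\dots,r_p\in\{0,1,\dots,p-1\}$, not all zero, and for each $j\in\{1,\dots,p\}$ let $\mathbf{e}^{(j)}_1,\dots,\mathbf{e}^{(j)}_{r_j}$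 be $\mathbb{F}_p$-linearly independent vectors, $\mathbf{e}^{(j)}_i=(e^{(j)}_{i,1},\dots,e^{(j)}_{i,p-1})\in\mathbb{F}_p^{\,p-1}$. Define directed automorphisms $b^{(j)}_i\in\operatorname{St}_{\operatorname{Aut}T}(1)$ recursively by $$\psi(b^{(j)}_i)=\bigl(a^{e^{(j)}_{i,j}},\dots,a^{e^{(j)}_{i,p-1}},\,b^{(j)}_i,\,a^{e^{(j)}_{i,1}},\dots,a^{e^{(j)}_{i,j-1}}\bigr).$$ The associated multi-EGS group is $\langle\{a\}\cup\{b^{(j)}_i\mid 1\le j\le p,\ 1\le i\le r_j\}\rangle$. A GGS-group is a group $\langle a,b\rangle$ with $\psi(b)=(a^{e_1},\dots,a^{e_{p-1}},b)$ for a non-zero vector $(e_1,\dots,e_{p-1})\in\mathbb{F}_p^{\,p-1}$. *)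

(* Defs.v *)
(* Setting: Mathematical Components, with the classical sets of MathComp-Analysis. *)
From HB Require Import structures.
From mathcomp Require Import all_boot all_order all_fingroup all_algebra.
From mathcomp Require Import finmap.
From mathcomp Require Import all_classical.

Set Implicit Arguments.
Unset Strict Implicit.
Unset Printing Implicit Defensive.

Local Open Scope classical_set_scope.
Local Open Scope group_scope.

(* The alphabet {1, ..., p} is 'I_p = {0, ..., p - 1}, so that every index in  *)
(* X, and every coordinate of a vector in F_p^(p-1), is shifted down by one.   *)
Definition word (p : nat) := seq 'I_p.

Section Words.
Variable p : nat.
Implicit Types u v w : word p.

Definition child u v := [exists x : 'I_p, v == rcons u x].

Definition edge u v := child u v || child v u.

Lemma childP u v : reflect (exists x, v = rcons u x) (child u v).
Proof. exact: 'exists_eqP. Qed.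

Lemma child_size u v : child u v -> size v = (size u).+1.
Proof. by case/childP=> x ->; rewrite size_rcons. Qed.

Lemma edge_cat w u v : edge (w ++ u) (w ++ v) = edge u v.
Proof.
suff cat_child s t : child (w ++ s) (w ++ t) = child s t by rewrite /edge !cat_child.
apply/childP/childP => -[x e]; exists x.
  by move: e; rewrite rcons_cat => /eqP; rewrite eqseq_cat // eqxx => /eqP.
by rewrite e rcons_cat.
Qed.

End Words.

Record tree_aut (p : nat) := TreeAut {
  aut_fun :> word p -> word p;
  aut_inv : word p -> word p;
  autK : cancel aut_fun aut_inv;
  autVK : cancel aut_inv aut_fun;
  aut_root : aut_fun [::] = [::];
  aut_edge : forall u v, edge (aut_fun u) (aut_fun v) = edge u v }.

Section TreeAutTheory.
Variable p : nat.
Implicit Types (f g : tree_aut p) (u v w : word p) (x : 'I_p).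

Lemma tree_autP f g : (forall u, f u = g u) -> f = g.
Proof.
case: f g => [f f' fK f'K f0 fe] [g g' gK g'K g0 ge] /= /funext efg; subst g.
have ei : f' = g' by apply/funext => u; rewrite -{1}(g'K u) fK.
by subst g'; congr TreeAut; exact: Prop_irrelevance.
Qed.

Lemma aut_inj f : injective f. Proof. exact: can_inj (@autK p f). Qed.

Lemma aut_child f u x : exists y, f (rcons u x) = rcons (f u) y.
Proof.
elim/last_ind: u x => [|u z IH] x.
  have : edge (f [::]) (f (rcons [::] x)).
    by rewrite aut_edge /edge; apply/orP; left; apply/childP; exists x.
  rewrite aut_root => /orP[/childP[y ->]|/child_size //]; by exists y.
have : edge (f (rcons u z)) (f (rcons (rcons u z) x)).
  by rewrite aut_edge /edge; apply/orP; left; apply/childP; exists x.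
case/orP => [/childP[y ->]|/childP[y]]; first by exists y.
have [y' ->] := IH z => /rcons_inj[/aut_inj e _].
by move: (congr1 size e); rewrite !size_rcons => /eqP; rewrite -{1}[size u]addn0 -addn2 eqn_add2l.
Qed.

Lemma aut_size f u : size (f u) = size u.
Proof.
elim/last_ind: u => [|u x IH]; first by rewrite aut_root.
by have [y ->] := aut_child f u x; rewrite !size_rcons IH.
Qed.

Lemma aut_prefix f u v : take (size u) (f (u ++ v)) = f u.
Proof.
elim/last_ind: v => [|v x IH]; first by rewrite cats0 -(aut_size f) take_size.
have [y] := aut_child f (u ++ v) x; rewrite -rcons_cat => ->.
by rewrite -cats1 takel_cat ?IH // aut_size size_cat leq_addr.
Qed.

Lemma build_edge (f g : word p -> word p) :
    cancel f g -> cancel g f ->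
    (forall u x, exists y, f (rcons u x) = rcons (f u) y) ->
    (forall u x, exists y, g (rcons u x) = rcons (g u) y) ->
  forall u v, edge (f u) (f v) = edge u v.
Proof.
move=> fK gK fc gc; suff child_f u v : child (f u) (f v) = child u v.
  by move=> u v; rewrite /edge !child_f.
apply/childP/childP => -[x e].
  by have [y ey] := gc (f u) x; exists y; rewrite -[v]fK e ey fK.
by rewrite e; have [y ->] := fc u x; exists y.
Qed.

Definition tree_aut1 : tree_aut p :=
  @TreeAut p id id (fun=> erefl) (fun=> erefl) erefl (fun _ _ => erefl).

Lemma aut_inv_root f : aut_inv f [::] = [::].
Proof. by rewrite -{1}(aut_root f) autK. Qed.

Lemma aut_inv_edge f u v : edge (aut_inv f u) (aut_inv f v) = edge u v.
Proof. by rewrite -(aut_edge f) !autVK. Qed.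

Definition tree_autV f : tree_aut p :=
  TreeAut (@autVK p f) (@autK p f) (aut_inv_root f) (aut_inv_edge f).

Lemma aut_mul_root f g : (g \o f) [::] = [::].
Proof. by rewrite /= !aut_root. Qed.

Lemma aut_mul_edge f g u v : edge ((g \o f) u) ((g \o f) v) = edge u v.
Proof. by rewrite /= !aut_edge. Qed.

(* Automorphisms act on the right: f * g is f followed by g. *)
Definition tree_autM f g : tree_aut p :=
  TreeAut (can_comp (@autK p g) (@autK p f)) (can_comp (@autVK p f) (@autVK p g))
    (aut_mul_root f g) (aut_mul_edge f g).

HB.instance Definition _ := gen_eqMixin (tree_aut p).
HB.instance Definition _ := gen_choiceMixin (tree_aut p).

Lemma tree_autA : associative tree_autM. Proof. by move=> f g h; exact: tree_autP. Qed.
Lemma tree_aut1M : left_id tree_aut1 tree_autM. Proof. by move=> f; exact: tree_autP. Qed.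
Lemma tree_autM1 : right_id tree_aut1 tree_autM. Proof. by move=> f; exact: tree_autP. Qed.
Lemma tree_autVM : left_inverse tree_aut1 tree_autV tree_autM.
Proof. by move=> f; apply: tree_autP => u /=; exact: autVK. Qed.
Lemma tree_autMV : right_inverse tree_aut1 tree_autV tree_autM.
Proof. by move=> f; apply: tree_autP => u /=; exact: autK. Qed.

HB.instance Definition _ := isGroup.Build (tree_aut p)
  tree_autA tree_aut1M tree_autM1 tree_autVM tree_autMV.

Lemma tree_autME f g u : (f * g) u = g (f u). Proof. by []. Qed.

Definition label_fun f u x : 'I_p := last x (f (rcons u x)).

Lemma label_funE f u x : f (rcons u x) = rcons (f u) (label_fun f u x).
Proof. by rewrite /label_fun; have [y ->] := aut_child f u x; rewrite last_rcons. Qed.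

Lemma label_fun_inj f u : injective (label_fun f u).
Proof.
move=> x y e; have := label_funE f u x; rewrite e -label_funE.
by move/aut_inj/rcons_inj => [].
Qed.

Definition label f u : 'S_p := perm (@label_fun_inj f u).

Lemma labelE f u x : f (rcons u x) = rcons (f u) (label f u x).
Proof. by rewrite permE label_funE. Qed.

Definition section_fun f u v : word p := drop (size u) (f (u ++ v)).

Lemma section_funE f u v : f (u ++ v) = f u ++ section_fun f u v.
Proof. by rewrite -[LHS](cat_take_drop (size u)) aut_prefix. Qed.

Lemma section_funK f u : cancel (section_fun f u) (section_fun (tree_autV f) (f u)).
Proof.
move=> v; rewrite /section_fun -/(section_fun f u v) -section_funE /= autK.
by rewrite aut_size drop_size_cat.
Qed.

Lemma section_funVK f u : cancel (section_fun (tree_autV f) (f u)) (section_fun f u).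
Proof. by move=> v; have := section_funK (tree_autV f) (f u) v; rewrite /= autK. Qed.

Lemma section_fun_root f u : section_fun f u [::] = [::].
Proof. by rewrite /section_fun cats0 -(aut_size f) drop_size. Qed.

Lemma section_fun_edge f u v w :
  edge (section_fun f u v) (section_fun f u w) = edge v w.
Proof. by rewrite -(edge_cat (f u)) -!section_funE aut_edge edge_cat. Qed.

Definition section f u : tree_aut p :=
  TreeAut (@section_funK f u) (@section_funVK f u)
    (section_fun_root f u) (@section_fun_edge f u).

Lemma sectionE f u v : f (u ++ v) = f u ++ section f u v.
Proof. exact: section_funE. Qed.

(* Used below only on elements of the first level stabiliser. *)
Definition psi f : 'I_p -> tree_aut p := fun x => section f [:: x].

Definition rooted_fun (s : 'S_p) u : word p := if u is x :: v then s x :: v else [::].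

Lemma rooted_funK s : cancel (rooted_fun s) (rooted_fun s^-1).
Proof. by case=> [|x v] //=; rewrite permK. Qed.

Lemma rooted_funVK s : cancel (rooted_fun s^-1) (rooted_fun s).
Proof. by case=> [|x v] //=; rewrite permKV. Qed.

Lemma rooted_fun_child s u x : exists y, rooted_fun s (rcons u x) = rcons (rooted_fun s u) y.
Proof. by case: u => [|y u]; [exists (s x) | exists x]. Qed.

Definition rooted (s : 'S_p) : tree_aut p :=
  TreeAut (@rooted_funK s) (@rooted_funVK s) erefl
    (build_edge (@rooted_funK s) (@rooted_funVK s)
       (rooted_fun_child s) (rooted_fun_child s^-1)).

Definition sigma : 'S_p := perm (@ordS_inj p).

Definition rot_a : tree_aut p := rooted sigma.

(* Recursive construction of the element of the first level stabiliser whose   *)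
(* section at x is g if c x = Some g, and the element itself if c x = None.    *)
Fixpoint spine_fun (c : 'I_p -> option (tree_aut p)) u : word p :=
  if u is x :: v then x :: (if c x is Some g then g v else spine_fun c v) else [::].

Lemma spine_funK c : cancel (spine_fun c) (spine_fun (fun x => omap tree_autV (c x))).
Proof. by elim=> [|x v IH] //=; case: (c x) => [g|] /=; rewrite ?autK ?IH. Qed.

Lemma spine_funVK c : cancel (spine_fun (fun x => omap tree_autV (c x))) (spine_fun c).
Proof. by elim=> [|x v IH] //=; case: (c x) => [g|] /=; rewrite ?autVK ?IH. Qed.

Lemma spine_fun_child c u x : exists y, spine_fun c (rcons u x) = rcons (spine_fun c u) y.
Proof.
elim: u => [|z u [y IH]] /=.
  by exists x; case: (c x) => [g|] //; rewrite aut_root.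
case: (c z) => [g|]; last by exists y; rewrite IH.
by have [y' ->] := aut_child g u x; exists y'.
Qed.

Definition spine c : tree_aut p :=
  TreeAut (@spine_funK c) (@spine_funVK c) erefl
    (build_edge (@spine_funK c) (@spine_funVK c) (spine_fun_child c) (spine_fun_child _)).

(* The tuple (a^(e_j), ..., a^(e_(p-1)), b, a^(e_1), ..., a^(e_(j-1))): with    *)
(* indices starting at 0, position x carries the exponent of index x + j mod p *)
(* when this is smaller than p - 1, and b otherwise. For j = 0 the tuple is    *)
(* (a^(e_1), ..., a^(e_(p-1)), b).                                             *)
Definition directed_tuple (j : nat) (e : 'rV['F_p]_p.-1) (b : tree_aut p) :
    'I_p -> tree_aut p :=
  fun x => if insub ((x + j) %% p)%N is Some i then rot_a ^+ (e ord0 i) else b.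

Definition directed (j : nat) (e : 'rV['F_p]_p.-1) : tree_aut p :=
  spine (fun x => omap (fun i => rot_a ^+ (e ord0 i)) (insub ((x + j) %% p)%N)).

Lemma psi_directed j e : psi (directed j e) = directed_tuple j e (directed j e).
Proof.
apply/funext => x; apply: tree_autP => v.
rewrite /psi /directed_tuple /= /section_fun /= drop0.
by case: insub.
Qed.

Implicit Types (G H K N : set (tree_aut p)).

Definition is_subgroup H : Prop := group_closed (mem H).

Definition subgroup_gen (A : set (tree_aut p)) : set (tree_aut p) := smallest is_subgroup A.

Definition normal_in N G : Prop :=
  [/\ is_subgroup N, N `<=` G & forall h g, N h -> G g -> N (h ^ g)].

Definition semidirect H N G : Prop :=
  [/\ is_subgroup H, H `<=` G, normal_in N G, H `&` N = [set 1] &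
      forall g, G g -> exists h n, [/\ H h, N n & g = h * n]].

Definition left_cosets G H : set (set (tree_aut p)) :=
  [set [set g * h | h in H] | g in G].

(* 0 when the index is infinite. *)
Definition gindex G H : nat := #|` fset_set (left_cosets G H)|.

Definition derived_subgroup G : set (tree_aut p) :=
  subgroup_gen [set h | exists f g, [/\ G f, G g & h = [~ f, g]]].

Definition group_automorphism G (phi : tree_aut p -> tree_aut p) : Prop :=
  set_bij G G phi /\ forall f g, G f -> G g -> phi (f * g) = phi f * phi g.

Definition characteristic_in H G : Prop :=
  [/\ is_subgroup H, H `<=` G & forall phi, group_automorphism G phi -> phi @` H = H].

Definition level_stab G (n : nat) : set (tree_aut p) :=
  [set g | G g /\ forall u : word p, size u = n -> g u = u].

Definition sylow_S : set (tree_aut p) := [set f | forall u, label f u \in (<[sigma]>)].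

Definition self_similar G : Prop :=
  forall u g, G g -> g u = u -> G (section g u).

Definition level_transitive G : Prop :=
  forall u v : word p, size u = size v -> exists2 g, G g & g u = v.

Definition regular_branch_over G K : Prop :=
  [/\ is_subgroup K /\ K `<=` G, finite_set (left_cosets G K),
      level_transitive G, self_similar G &
      [set k : 'I_p -> tree_aut p | forall x, K (k x)] `<=`
        psi @` (level_stab G 1 `&` K)].

Definition multi_EGS G : Prop :=
  exists (r : 'I_p -> nat) (E : forall j, 'M['F_p]_(r j, p.-1)),
    [/\ forall j, (r j < p)%N, exists j, r j != 0%N, forall j, row_free (E j) &
        G = subgroup_gen
              ([set rot_a] `|`
               [set g | exists (j : 'I_p) (i : 'I_(r j)), g = directed j (row i (E j))])].

(* G is the GGS-group generated by a and b. *)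
Definition GGS_with G (b : tree_aut p) : Prop :=
  exists e : 'rV['F_p]_p.-1,
    [/\ e != 0%R, level_stab setT 1 b, psi b = directed_tuple 0 e b &
        G = subgroup_gen [set rot_a; b]].

(* log_p |St_G(m) : St_G(m+1)| *)
Definition layer_length G (m : nat) : nat :=
  trunc_log p (gindex (level_stab G m) (level_stab G m.+1)).

End TreeAutTheory.

Arguments rot_a {p}.
Arguments sylow_S {p}.

(* Main.v *)
Require Import Defs.
From mathcomp Require Import all_boot all_order all_fingroup all_algebra.
From mathcomp Require Import cyclic commutator pgroup center nilpotent sylow.
From mathcomp Require Import finmap.
From mathcomp Require Import all_classical.

Local Open Scope classical_set_scope.

(* An element c of S is a p^n-cycle on every level n as soon as the exponents  *)
(* of its labels on each level have a nonzero sum, and c = a b is one. Labels  *)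
(* on level m embed St_G(m) / St_G(m+1) into the functions from level m to     *)
(* F_p, on which c has a one-dimensional fixed space; so c-invariant subgroups *)
(* are nested by order, while the finite p-group G / St_G(m+1) normalises one  *)
(* of every order. This is the chain.                                          *)
(*                                                                             *)
(* Level stabilisers are characteristic because, with q = p^n, an element g of *)
(* G fixes level n if and only if for every q-th power X <> 1 in G there are   *)
(* q-th powers R, H in G such that X^R and X^(g H) do not commute. This rests  *)
(* on nontrivial elements of G supported below each vertex, found in <a, b>'': *)
(* every element of that subgroup reappears in it on each first-level subtree. *)
(* An automorphism then permutes the chain monotonically, hence trivially.     *)
(*                                                                             *)
(* In the GGS case the labels of g in St_G(1) are obtained from the level-one  *)
(* label sums of its sections by a cyclic convolution with (e_1, ..., e_(p-1), *)
(* 0), which is invertible as the e_i have a nonzero sum. Hence psi maps       *)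
(* St_G(m) onto St_G'(m-1)^p for m >= 2, and the layers can be counted.        *)

(** Existence and uniqueness of the chain. Let P be the action of G on level m+1 and V that of
    St_G(m). An element of V is determined by its label exponents on level m ([perm_of_lab_exp]), so
    V is abelian. The powers of c = ab are transitive on level m ([odometer_ab], [odometer_trans]),
    so an element of V commuting with c has constant exponents, and C_V(c) has order at most p
    ([card_cent_stab_image]). For such an action, c-invariant subgroups of V are comparable
    ([uniserial]); with normal subgroups of every order in the p-group P this gives [layer_chain].

    Invariance under automorphisms. The two halves of the commutation criterion are
    [stab_noncommuting] and [noncommuting_stab]; being purely group-theoretic, it is preserved by
    automorphisms ([aut_level_stab]). It needs elements below every vertex, supplied by
    [ggs_weakly_branch]. [characteristic_chain] passes from the level stabilisers to the chain
    between them.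

    Layer sizes. Splitting a label vector by the first letter embeds layer m+1 into the p-th power
    of layer m ([card_layer_le]). For a GGS-group, level sums identify the derived subgroup D
    ([derived_mem]), and [stab_convolution] with [convolution_inj] shows that sections of elements
    of St_G(2) lie in D. Branching gives the converse, whence the recursion [card_layer_succ], which
    starts from a zero-sum hyperplane in F_p^p. *)

Section Uniserial.
Set Implicit Arguments.
Unset Strict Implicit.
Local Open Scope group_scope.
Variables (gT : finGroupType) (p : nat) (V : {group gT}) (c : gT).
Hypotheses (p_pr : prime p) (pV : p.-group V) (pc : p.-elt c) (nVc : c \in 'N(V)).
Hypotheses (cVV : abelian V) (cV : #|'C_V[c]| <= p).

Lemma commV : {in V, forall x, [~ x, c] \in V}.
Proof. by move=> x Vx; rewrite commgEl groupM ?groupV ?memJ_norm. Qed.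

(** This comes from [xy, c] = [x, c]^y [y, c], where the conjugation by y disappears because V is
    abelian. *)
Lemma commV_morph : {in V &, {morph (fun x => [~ x, c]) : x y / x * y}}.
Proof.
move=> x y Vx Vy /=; rewrite commMgJ; congr (_ * _).
by apply/conjg_fixP/commgP/(centsP cVV) => //; apply: commV.
Qed.
Canonical commV_morphism := Morphism commV_morph.

(** H is a nontrivial normal subgroup of the p-group generated by H and c, so it meets the centre of
    that group. *)
Lemma dvdn_centraliser (H : {group gT}) : H \subset V -> c \in 'N(H) -> H :!=: 1 ->
  p %| #|'C_H[c]|.
Proof.
move=> sHV nHc H1.
have pH := pgroupS sHV pV.
have pHc : p.-group (H <*> <[c]>).
  by rewrite norm_joinEr ?cycle_subG // pgroupM pH.
have : H :&: 'Z(H <*> <[c]>) != 1.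
  by rewrite meet_center_nil ?(pgroup_nil pHc) // /normal joing_subl join_subG normG cycle_subG.
rewrite trivg_card1 => n1.
have sub : H :&: 'Z(H <*> <[c]>) \subset 'C_H[c].
  rewrite finset.setIS // finset.subIset //; apply/orP; right.
  by rewrite -cent_cycle centS // joing_subr.
have pC : p.-group 'C_H[c] by rewrite (pgroupS _ pH) // subsetIl.
have [|nC1] := boolP ('C_H[c]%G :==: 1).
  by move=> /eqP C1; move: sub n1; rewrite C1 => /trivgP->; rewrite cards1.
by have [] := pgroup_pdiv pC nC1.
Qed.

Lemma card_centraliser (H : {group gT}) : H \subset V -> c \in 'N(H) -> H :!=: 1 ->
  #|'C_H[c]| = p.
Proof.
move=> sHV nHc H1; apply/eqP; rewrite eqn_leq (leq_trans (subset_leq_card _) cV) ?finset.setSI //=.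
by rewrite dvdn_leq ?cardG_gt0 ?dvdn_centraliser.
Qed.

Lemma centraliser_eq (H : {group gT}) : H \subset V -> c \in 'N(H) -> H :!=: 1 ->
  'C_H[c] = 'C_V[c].
Proof.
move=> sHV nHc H1; apply/eqP; rewrite eqEcard finset.setSI //=.
by rewrite (card_centraliser sHV nHc H1).
Qed.

(** The kernel on H of x |-> [x, c] is 'C_H[c], of order p. Passing to the image thus divides the
    order by p, which drives the induction in [uniserial]. *)
Lemma card_commV (H : {group gT}) : H \subset V -> c \in 'N(H) -> H :!=: 1 ->
  #|H| = (p * #|commV_morphism @* H|)%N.
Proof.
move=> sHV nHc H1; rewrite card_morphim (finset.setIidPr sHV) -(card_centraliser sHV nHc H1).
rewrite -(LagrangeI H ('ker commV_morphism)); congr (_ * _)%N.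
apply: eq_card => x; rewrite [LHS]finset.in_setI [RHS]finset.in_setI.
case: (boolP (x \in H)) => //= /(fintype.subsetP sHV) Vx.
by apply/(kerP _ Vx)/cent1P => /= [/eqP/commgP|/commgP/eqP].
Qed.

Lemma commV_norm (H : {group gT}) : H \subset V -> c \in 'N(H) ->
  c \in 'N(commV_morphism @* H).
Proof.
move=> sHV nHc; rewrite inE; apply/fintype.subsetP => _ /imsetP[_ /morphimP[x Vx Hx ->] ->].
rewrite /= conjRg [c ^ c]conjgE mulKg; apply/morphimP; exists (x ^ c) => //.
  by rewrite memJ_norm.
by rewrite memJ_norm.
Qed.

Lemma commV_sub (H : {group gT}) : H \subset V -> commV_morphism @* H \subset V.
Proof. by move=> sHV; apply/fintype.subsetP => _ /morphimP[x Vx _ ->]; apply: commV. Qed.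

(* Induction through the commutators with c: the fibres of x |-> [~ x, c] on   *)
(* a nontrivial c-invariant subgroup are the cosets of the full 'C_V[c].       *)
Lemma uniserial (H K : {group gT}) : H \subset V -> K \subset V ->
  c \in 'N(H) -> c \in 'N(K) -> #|H| <= #|K| -> H \subset K.
Proof.
have [n] := ubnP #|H|; elim: n H K => // n IH H K ltHn sHV sKV nHc nKc leHK.
have [/eqP->|H1] := boolP (H :==: 1); first exact: sub1G.
have K1 : K :!=: 1.
  by rewrite -cardG_gt1 (leq_trans _ leHK) // cardG_gt1.
have cardH := card_commV sHV nHc H1; have cardK := card_commV sKV nKc K1.
have sTT : commV_morphism @* H \subset commV_morphism @* K.
  apply: (IH [group of commV_morphism @* H] [group of commV_morphism @* K]);
    rewrite /= ?commV_sub ?commV_norm //.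
    rewrite -ltnS (leq_trans _ ltHn) // ltnS cardH -[X in (X < _)%N]mul1n.
    by rewrite ltn_pmul2r ?cardG_gt0 // prime_gt1.
  by rewrite -(leq_pmul2l (prime_gt0 p_pr)) -cardH -cardK.
apply/fintype.subsetP => x Hx; have Vx := fintype.subsetP sHV x Hx.
have /(fintype.subsetP sTT)/morphimP[y Vy Ky /= exy] : [~ x, c] \in commV_morphism @* H.
  by apply/morphimP; exists x.
suff : x * y^-1 \in 'C_K[c] by case/finset.setIP => + _; rewrite groupMr ?groupV.
rewrite centraliser_eq // inE groupM ?groupV //=.
apply/cent1P/commgP/eqP.
have /= -> := commV_morph Vx (groupVr Vy).
by have /= -> := morphV commV_morphism Vy; rewrite exy mulgV.
Qed.

End Uniserial.

Lemma expg_modn {gT : groupType} (x : gT) n k : (x ^+ n = 1 -> x ^+ k = x ^+ (k %% n))%g.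
Proof. by move=> xn; rewrite {1}(divn_eq k n) expgnDr mulnC expgnA xn expg1n mul1g. Qed.

(** Normal forms below use powers with natural exponents; this keeps them closed under inverses. *)
Lemma expVg_period {gT : groupType} (x : gT) n k :
  (0 < n -> x ^+ n = 1 -> x ^- k = x ^+ (k * n.-1))%g.
Proof.
move=> n0 xn; apply: (@mulgI _ (x ^+ k)%g); rewrite mulgV -expgnDr -mulnS prednK //.
by rewrite mulnC expgnA xn expg1n.
Qed.

(** * Sections, labels and label exponents *)

Section TreeAction.
Set Implicit Arguments.
Unset Strict Implicit.
Local Open Scope group_scope.
Variable p : nat.
Implicit Types (f g h : tree_aut p) (u v w : word p) (x y : 'I_p) (G H : set (tree_aut p)).

Lemma aut1E u : (1 : tree_aut p) u = u. Proof. by []. Qed.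
Lemma autVKE f u : f^-1 (f u) = u. Proof. exact: autK. Qed.
Lemma autKVE f u : f (f^-1 u) = u. Proof. exact: autVK. Qed.

Lemma autXE f n u : (f ^+ n) u = iter n f u.
Proof. by elim: n u => [|n IH] u //; rewrite expgSr tree_autME IH iterS. Qed.

Lemma autX_fix f n u : f u = u -> (f ^+ n) u = u.
Proof. by move=> fu; rewrite autXE; elim: n => //= n ->. Qed.

Lemma autV_fix f u : f u = u -> f^-1 u = u.
Proof. by move=> fu; rewrite -{1}fu autVKE. Qed.

Lemma autJE f g u : (f ^ g) (g u) = g (f u).
Proof. by rewrite conjgE !tree_autME autVKE. Qed.

Lemma section_eq f u v w : f (u ++ v) = f u ++ w -> section f u v = w.
Proof. by rewrite sectionE => /eqP; rewrite eqseq_cat // eqxx => /eqP. Qed.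

Lemma section1 u : section (1 : tree_aut p) u = 1.
Proof. by apply: tree_autP => v; apply: section_eq. Qed.

Lemma sectionM f g u : section (f * g) u = section f u * section g (f u).
Proof. by apply: tree_autP => v; apply: section_eq; rewrite !tree_autME -!sectionE. Qed.

Lemma sectionV f u : section f^-1 u = (section f (f^-1 u))^-1.
Proof.
apply: (@mulgI _ (section f (f^-1 u))); rewrite mulgV.
by rewrite -{2}(autKVE f u) -sectionM mulgV section1.
Qed.

Lemma section_cat f u v : section (section f u) v = section f (u ++ v).
Proof.
apply: tree_autP => w; symmetry; apply: section_eq.
by rewrite -catA 2!sectionE catA -sectionE.
Qed.

Lemma labelM f g u : label (f * g) u = label f u * label g (f u).
Proof.
apply/permP => x; rewrite permM.
have := labelE (f * g) u x; rewrite tree_autME !labelE.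
by case/rcons_inj.
Qed.

Lemma label_section f u v : label (section f u) v = label f (u ++ v).
Proof.
apply/permP => x; have := sectionE f u (rcons v x).
by rewrite labelE -!rcons_cat -sectionE labelE => /rcons_inj[].
Qed.

Lemma label1 u : label (1 : tree_aut p) u = 1.
Proof. by apply/permP => x; have := labelE 1 u x; rewrite aut1E perm1 => /rcons_inj[]. Qed.

Lemma labelV f u : label f^-1 u = (label f (f^-1 u))^-1.
Proof.
apply: (@mulgI _ (label f (f^-1 u))); rewrite mulgV.
by rewrite -{2}(autKVE f u) -labelM mulgV label1.
Qed.

Lemma aut1word f x : f [:: x] = [:: label f [::] x].
Proof. by rewrite (labelE f [::] x) aut_root. Qed.

Lemma sylow_S_subgroup : is_subgroup (@sylow_S p).
Proof.
split=> [|f g]; rewrite !inE; first by move=> u; rewrite label1 group1.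
move=> fS gS u; rewrite labelM labelV groupM ?groupV //; exact: fS.
Qed.

Lemma sylowM f g : sylow_S f -> sylow_S g -> sylow_S (f * g).
Proof. by have := @group_closedM _ _ sylow_S_subgroup f g; rewrite !inE. Qed.
Lemma sylowV f : sylow_S f -> sylow_S f^-1.
Proof. by have := @group_closedV _ _ sylow_S_subgroup f; rewrite !inE. Qed.
Lemma sylowX f n : sylow_S f -> sylow_S (f ^+ n).
Proof.
move=> fS; elim: n => [|n IH]; first by case: sylow_S_subgroup; rewrite inE.
by rewrite expgS; apply: sylowM.
Qed.
Lemma sylowJ f g : sylow_S f -> sylow_S g -> sylow_S (f ^ g).
Proof. by move=> fS gS; rewrite conjgE; apply/sylowM/sylowM => //; apply: sylowV. Qed.

Lemma section_sylow f u : sylow_S f -> sylow_S (section f u).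
Proof. by move=> fS v; rewrite label_section. Qed.

Lemma subgroup1 (H : set (tree_aut p)) : is_subgroup H -> H 1.
Proof. by case; rewrite inE. Qed.
Lemma subgroupM (H : set (tree_aut p)) f g : is_subgroup H -> H f -> H g -> H (f * g).
Proof. by move/group_closedM => H1 Hf Hg; move: (H1 f g); rewrite !inE; apply. Qed.
Lemma subgroupV (H : set (tree_aut p)) f : is_subgroup H -> H f -> H f^-1.
Proof. by move/group_closedV => H1 Hf; move: (H1 f); rewrite !inE; apply. Qed.
Lemma subgroupX (H : set (tree_aut p)) f n : is_subgroup H -> H f -> H (f ^+ n).
Proof.
move=> HH Hf; elim: n => [|n IH]; first exact: subgroup1.
by rewrite expgS; apply: subgroupM.
Qed.
Lemma subgroupJ (H : set (tree_aut p)) f g : is_subgroup H -> H f -> H g -> H (f ^ g).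
Proof.
by move=> HH Hf Hg; rewrite conjgE; do !apply: subgroupM => //; apply: subgroupV.
Qed.
Lemma subgroupR (H : set (tree_aut p)) f g : is_subgroup H -> H f -> H g -> H [~ f, g].
Proof.
by move=> HH Hf Hg; rewrite commgEl; apply: subgroupM; [|exact: subgroupV|exact: subgroupJ].
Qed.

Lemma subgroupP (H : set (tree_aut p)) :
  H 1 -> (forall f g, H f -> H g -> H (f * g)) -> (forall f, H f -> H f^-1) -> is_subgroup H.
Proof.
by move=> H1 HM HV; split=> [|f g]; rewrite !inE // => Hf Hg; apply/HM/HV.
Qed.

Lemma subgroup_genP (A : set (tree_aut p)) : is_subgroup (subgroup_gen A).
Proof.
split=> [|f g]; rewrite !inE; first by move=> B [BG _]; exact: subgroup1.
move=> fG gG B [BG AB].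
have Bf := fG B (conj BG AB); have Bg := gG B (conj BG AB).
by apply: subgroupM => //; apply: subgroupV.
Qed.

Lemma sub_subgroup_gen (A : set (tree_aut p)) : A `<=` subgroup_gen A.
Proof. by move=> f Af B [_]; apply. Qed.

Lemma subgroup_gen_min (A B : set (tree_aut p)) : is_subgroup B -> A `<=` B -> subgroup_gen A `<=` B.
Proof. by move=> BG AB f; apply. Qed.

Lemma level_stab_subgroup G n : is_subgroup G -> is_subgroup (level_stab G n).
Proof.
move=> GG; apply: subgroupP => [|f g [Gf fn] [Gg gn]|f [Gf fn]]; split.
- exact: subgroup1.
- by [].
- exact: subgroupM.
- by move=> u un; rewrite tree_autME fn ?gn.
- exact: subgroupV.
- by move=> u un; rewrite autV_fix ?fn.
Qed.

Lemma level_stabJ G n f g : is_subgroup G -> level_stab G n f -> G g -> level_stab G n (f ^ g).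
Proof.
move=> GG [Gf fn] Gg; split=> [|u un]; first exact: subgroupJ.
by rewrite -{1}(autKVE g u) autJE fn ?aut_size // autKVE.
Qed.

Lemma level_stab_fix G n f u : level_stab G n f -> size u <= n -> f u = u.
Proof.
move=> [_ fn] un.
case: u un => [|x u] un; first exact: aut_root.
have := aut_prefix f (x :: u) (nseq (n - size (x :: u)) x).
rewrite fn; last by rewrite size_cat size_nseq subnKC.
by rewrite take_size_cat.
Qed.

Lemma level_stabS G m n f : (m <= n)%N -> level_stab G n f -> level_stab G m f.
Proof. by move=> mn fn; split=> [|u um]; [case: fn|apply: (level_stab_fix fn); rewrite um]. Qed.

Lemma fix_prefix f u v : f (u ++ v) = u ++ v -> f u = u.
Proof. by move=> e; have := aut_prefix f u v; rewrite e take_size_cat. Qed.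

End TreeAction.

Section Exponents.
Set Implicit Arguments.
Unset Strict Implicit.
Local Open Scope group_scope.
Variable p : nat.
Hypothesis p_prime : prime p.
Implicit Types (f g h : tree_aut p) (u v w : word p) (x y : 'I_p) (G H : set (tree_aut p)).
Notation S := (@sylow_S p).

(** Identifies the alphabet with F_p, so that [sigma] becomes the translation by 1. *)
Definition res x : 'F_p := (val x)%:R%R.

Lemma res_inj : injective res.
Proof.
move=> x y; rewrite /res => /(congr1 (@nat_of_ord _)); rewrite !val_Fp_nat //.
by rewrite /= !modn_small ?ltn_ord // => /val_inj.
Qed.

Lemma res0 x : val x = 0%N -> res x = 0%R.
Proof. by rewrite /res => ->. Qed.

Lemma res_surj (k : 'F_p) : exists x, res x = k.
Proof.
have kp : (k < p)%N by rewrite -[p in ltnRHS](Fp_cast p_prime).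
exists (Ordinal kp); apply: ord_inj; rewrite /res val_Fp_nat //= modn_small //.
Qed.

Lemma res_sigmaX k x : res ((@sigma p ^+ k) x) = (res x + k%:R)%R.
Proof.
elim: k => [|k IH]; first by rewrite expg0 perm1 GRing.addr0.
rewrite expgSr permM permE -GRing.natr1 GRing.addrA -IH /res /=.
by rewrite Fp_nat_mod // -GRing.natr1.
Qed.

(* For f in S the label of f at u is sigma ^+ lab_exp f u; it is read off at the
   letter 0. *)
Definition lab_exp f u : 'F_p := if insub 0%N is Some x then res (label f u x) else 0%R.

Lemma lab_expP f u x : S f -> res (label f u x) = (res x + lab_exp f u)%R.
Proof.
move=> /(_ u) /cycleP[k ek]; rewrite /lab_exp; case: insubP => [y _ y0|].
  by rewrite ek !res_sigmaX (res0 y0) GRing.add0r.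
by rewrite prime_gt0.
Qed.

Lemma lab_expM f g u : S f -> S g -> lab_exp (f * g) u = (lab_exp f u + lab_exp g (f u))%R.
Proof.
move=> fS gS; have [x x0] := res_surj 0%R.
have := lab_expP u x (sylowM fS gS); rewrite labelM permM !lab_expP //.
by rewrite -GRing.addrA => /GRing.addrI <-.
Qed.

Lemma lab_exp_section f u v : lab_exp (section f u) v = lab_exp f (u ++ v).
Proof. by rewrite /lab_exp label_section. Qed.

Lemma lab_exp1 u : lab_exp (1 : tree_aut p) u = 0%R.
Proof.
rewrite /lab_exp; case: insubP => // y _ y0.
by rewrite label1 perm1 res0.
Qed.

Lemma lab_expV f u : S f -> lab_exp f^-1 u = (- lab_exp f (f^-1 u)%g)%R.
Proof.
move=> fS; apply/eqP; rewrite -GRing.addr_eq0 GRing.addrC; apply/eqP.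
have := lab_expM (f^-1 u)%g fS (sylowV fS).
by rewrite autKVE mulgV lab_exp1.
Qed.

Lemma lab_expJ f g u : S f -> S g -> f u = u -> lab_exp (f ^ g) (g u) = lab_exp f u.
Proof.
move=> fS gS fu; have := lab_expM u gS (sylowJ fS gS).
by rewrite conjgE mulVKg lab_expM // fu GRing.addrC => /GRing.addrI ->.
Qed.

Lemma lab_expX f u n : S f -> f u = u -> lab_exp (f ^+ n) u = (lab_exp f u *+ n)%R.
Proof.
move=> fS fu; elim: n => [|n IH]; first by rewrite lab_exp1.
by rewrite expgS lab_expM ?fu ?IH ?GRing.mulrS //; exact: (sylowX n fS).
Qed.

Lemma lab_exp_fix f u x : S f -> f u = u -> (f (rcons u x) == rcons u x) = (lab_exp f u == 0)%R.
Proof.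
move=> fS fu; rewrite labelE fu eqseq_rcons eqxx /=.
by rewrite -(inj_eq res_inj) lab_expP // -{2}[res x]GRing.addr0 (inj_eq (GRing.addrI _)).
Qed.

Lemma lab_exp0_fix f u : S f -> f u = u -> lab_exp f u = 0%R -> forall x, f (rcons u x) = rcons u x.
Proof. by move=> fS fu e x; apply/eqP; rewrite lab_exp_fix // e. Qed.

Lemma stab_succ G f n : S f -> level_stab G n f ->
  (forall u, size u = n -> lab_exp f u = 0%R) -> level_stab G n.+1 f.
Proof.
move=> fS fn e; split=> [|]; first by case: fn.
elim/last_ind => // u x _; rewrite size_rcons => -[un].
by apply: lab_exp0_fix; rewrite ?e //; case: fn => _ ->.
Qed.

Lemma stab_lab_exp0 G f n u : S f -> level_stab G n f -> (size u < n)%N -> lab_exp f u = 0%R.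
Proof.
move=> fS fn un; have [x _] := res_surj 0%R.
apply/eqP; rewrite -(lab_exp_fix x fS (level_stab_fix fn (ltnW un))).
by rewrite (level_stab_fix fn) // size_rcons.
Qed.

(** If an element of S fixes level n, the level-n exponents of its p-th power are p times its own,
    hence zero, and the p-th power fixes level n+1. *)
Lemma pow_stab n f : S f -> level_stab S n (f ^+ (p ^ n)).
Proof.
move=> fS; elim: n => [|n IH].
  by split=> [|[]// _]; [exact: sylowX|exact: aut_root].
rewrite expnSr expgnA; apply: stab_succ; first exact/sylowX/sylowX.
  exact/(subgroupX _ (level_stab_subgroup n (sylow_S_subgroup p))).
move=> u un; rewrite lab_expX; [|exact: sylowX|by case: IH => _; apply].
by rewrite -GRing.mulr_natr pchar_Fp_0 // GRing.mulr0.
Qed.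

End Exponents.

(** * Level sums and odometers *)

Section Odometers.
Set Implicit Arguments.
Unset Strict Implicit.
Local Open Scope group_scope.
Variable p : nat.
Hypothesis p_prime : prime p.
Implicit Types (f g h c : tree_aut p) (u v w : word p) (x y : 'I_p).
Notation S := (@sylow_S p).

(** The sum of all label exponents on level n, computed through sections to suit induction on the
    level. *)
Fixpoint level_sum n f : 'F_p :=
  if n is m.+1 then (\sum_(x < p) level_sum m (section f [:: x]))%R else lab_exp f [::].

(** The level sums are homomorphisms from S to F_p: the sections of g occur at letters permuted by
    f, and the sum does not see the order. *)
Lemma level_sumM n f g : S f -> S g -> level_sum n (f * g) = (level_sum n f + level_sum n g)%R.
Proof.
elim: n f g => [|n IH] f g fS gS /=; first by rewrite lab_expM // aut_root.
rewrite (eq_bigr (fun x => level_sum n (section f [:: x]) + level_sum n (section g [:: label f [::] x]))%R).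
  rewrite big_split /=; congr (_ + _)%R.
  by rewrite [RHS](reindex_perm (label f [::])).
by move=> x _; rewrite sectionM IH ?aut1word //; exact: section_sylow.
Qed.

Lemma level_sum1 n : level_sum n (1 : tree_aut p) = 0%R.
Proof.
elim: n => [|n IH] /=; first exact: lab_exp1.
by apply: big1 => x _; rewrite section1.
Qed.

Lemma level_sumV n f : S f -> level_sum n f^-1 = (- level_sum n f)%R.
Proof.
move=> fS; apply/eqP; rewrite -GRing.addr_eq0 GRing.addrC -level_sumM ?mulgV ?level_sum1 //.
exact: sylowV.
Qed.

Lemma level_sumX n f k : S f -> level_sum n (f ^+ k) = (level_sum n f *+ k)%R.
Proof.
move=> fS; elim: k => [|k IH]; first exact: level_sum1.
by rewrite expgS level_sumM ?IH ?GRing.mulrS //; exact: sylowX.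
Qed.

Lemma level_sumJ n f g : S f -> S g -> level_sum n (f ^ g) = level_sum n f.
Proof.
move=> fS gS; rewrite conjgE (level_sumM n (sylowV gS) (sylowM fS gS)) (level_sumM n fS gS) (level_sumV n gS).
by rewrite GRing.addrCA GRing.addNr GRing.addr0.
Qed.

Lemma level_sumR n f g : S f -> S g -> level_sum n [~ f, g] = 0%R.
Proof.
move=> fS gS.
by rewrite commgEl (level_sumM n (sylowV fS) (sylowJ fS gS)) level_sumV // level_sumJ // GRing.addNr.
Qed.

Lemma lab_exp_root0 f x : S f -> f [:: x] = [:: x] -> lab_exp f [::] = 0%R.
Proof.
move=> fS; rewrite aut1word => -[e].
have := lab_expP p_prime [::] x fS; rewrite e => /esym/eqP.
by rewrite -GRing.subr_eq0 GRing.addrC GRing.addrA GRing.addNr GRing.add0r => /eqP.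
Qed.

Lemma powX_cons f x w j : f [:: x] = [:: x] ->
  (f ^+ j) (x :: w) = x :: (section f [:: x] ^+ j) w.
Proof.
move=> fx; elim: j w => [|j IH] w //.
by rewrite !expgS !tree_autME -IH -cat1s sectionE fx.
Qed.

(* An element of S acts as a p^n-cycle on every level n when the exponents of  *)
(* its labels on each level have a nonzero sum.                                *)
Definition odometer c := S c /\ forall n, level_sum n c <> 0%R.

Lemma lab_expX_root f n : S f -> lab_exp (f ^+ n) [::] = (lab_exp f [::] * n%:R)%R.
Proof. by move=> fS; rewrite lab_expX ?aut_root // GRing.mulr_natr. Qed.

(** The section of c^p at x is the product of the sections of c along the p-cycle through x, which
    visits each letter once. Its sum on level n is therefore the sum of c on level n+1. *)
Lemma odometer_section c x : odometer c -> odometer (section (c ^+ p) [:: x]).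
Proof.
move=> [cS cn]; split; first exact/section_sylow/sylowX.
move=> n; suff -> : level_sum n (section (c ^+ p) [:: x]) = level_sum n.+1 c by exact: cn.
have -> k : level_sum n (section (c ^+ k)%g [:: x]) =
    (\sum_(i < k) level_sum n (section c [:: label (c ^+ i)%g [::] x]))%R.
  elim: k => [|k IH]; first by rewrite big_ord0 section1 level_sum1.
  rewrite expgSr sectionM level_sumM ?aut1word; try exact/section_sylow/sylowX.
    by rewrite IH big_ord_recr.
  exact: section_sylow.
rewrite /= [RHS](reindex (fun i : 'I_p => label (c ^+ i) [::] x)) //=.
apply: onW_bij; apply: injF_bij => i j /(congr1 (@res p)).
rewrite !lab_expP //; try exact: sylowX.
move/GRing.addrI; rewrite !lab_expX_root // => /(GRing.mulfI _).
by move=> /(_ (introN eqP (cn 0)))/res_inj; apply.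
Qed.

Lemma odometer_step c x y : odometer c -> exists i, (c ^+ i) [:: x] = [:: y].
Proof.
move=> [cS cn]; pose k := ((res y - res x) / lab_exp c [::] : 'F_p)%R.
exists (val k); rewrite aut1word; congr [:: _]; apply: (res_inj p_prime).
rewrite lab_expP //; last exact: sylowX.
rewrite lab_expX_root //.
have -> : (val k)%:R%R = k by exact: natr_Zp.
have -> : (lab_exp c [::] * k = res y - res x)%R.
  by rewrite /k GRing.mulrC GRing.divfK //; exact/eqP/(cn 0%N).
by rewrite GRing.addrC GRing.subrK.
Qed.

Lemma pow_fix1 f x : S f -> (f ^+ p) [:: x] = [:: x].
Proof.
move=> fS; have := pow_stab p_prime 1 fS; rewrite expn1 => /level_stab_fix.
exact.
Qed.

(** Powers of c adjust the first letter; then multiples of p as exponents act on the remaining word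
    through the odometer which is the section of c^p. *)
Lemma odometer_trans c u v : odometer c -> size u = size v -> exists i, (c ^+ i) u = v.
Proof.
elim: v u c => [|y v IH] [|x u] // c co; first by exists 0%N.
move=> -[uv]; have [i ei] := odometer_step x y co; have cS := co.1.
have uv' : size (section (c ^+ i) [:: x] u) = size v by rewrite aut_size.
have [] := IH _ _ (odometer_section y co) uv'.
move=> j ej; exists (i + p * j)%N; rewrite expgnDr expgnA tree_autME.
by rewrite -[x :: u]cat1s sectionE ei /= powX_cons ?ej //; exact: pow_fix1.
Qed.

(** The same digit-by-digit descent: fixing the first letter forces p to divide i, and the section
    of c^p takes over. *)
Lemma odometer_dvd c i u : odometer c -> (c ^+ i) u = u -> p ^ size u %| i.
Proof.
elim: u i c => [|x u IH] i c co //= ciu; have cS := co.1.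
have cix : (c ^+ i) [:: x] = [:: x] by apply: (@fix_prefix _ _ _ u).
have : (lab_exp c [::] * i%:R = 0)%R by rewrite -lab_expX_root // (lab_exp_root0 _ cix) //; exact: sylowX.
move/eqP; rewrite GRing.mulf_eq0 (introF eqP (co.2 0%N)) /= -(GRing.dvdn_pcharf (pchar_Fp p_prime)).
case/dvdnP => j ij; move: ciu; rewrite ij mulnC expgnA powX_cons; last exact: pow_fix1.
by case=> /(IH _ _ (odometer_section x co)); rewrite expnS dvdn_pmul2l // prime_gt0.
Qed.

End Odometers.

Lemma commgM_r {gT : groupType} (f g h : gT) :
  ([~ f, g * h] = [~ f, h] * [~ f, g] ^ h)%g.
Proof.
by rewrite !commgEl conjMg -!conjgM conjVg [RHS]mulgA mulgK.
Qed.

(** * The first level stabiliser and the rooted automorphism *)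

Section FirstLevel.
Set Implicit Arguments.
Unset Strict Implicit.
Local Open Scope group_scope.
Variable p : nat.
Hypothesis p_prime : prime p.
Implicit Types (f g h c : tree_aut p) (u v w : word p) (x y : 'I_p) (G H N : set (tree_aut p)).
Notation S := (@sylow_S p).
Notation a := (@rot_a p).

Definition fix1 f := forall x, f [:: x] = [:: x].

Lemma fix1_stab G f : G f -> fix1 f -> level_stab G 1 f.
Proof. by move=> Gf f1; split=> // -[|x [|]]. Qed.

Lemma stab_fix1 G f : level_stab G 1 f -> fix1 f.
Proof. by case=> _ f1 x; apply: f1. Qed.

Lemma fix1_1 : fix1 1. Proof. by []. Qed.
Lemma fix1M f g : fix1 f -> fix1 g -> fix1 (f * g).
Proof. by move=> f1 g1 x; rewrite tree_autME f1 g1. Qed.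
Lemma fix1V f : fix1 f -> fix1 f^-1.
Proof. by move=> f1 x; rewrite autV_fix. Qed.
Lemma fix1J f g : fix1 f -> fix1 (f ^ g).
Proof.
move=> f1 x; have := autJE f g (g^-1 [:: x]); rewrite autKVE => ->.
have -> : g^-1 [:: x] = [:: label g^-1 [::] x] by rewrite aut1word.
by rewrite f1 -aut1word autKVE.
Qed.
Lemma fix1R f g : fix1 f -> fix1 g -> fix1 [~ f, g].
Proof. by move=> f1 g1; rewrite commgEl; apply: fix1M; [exact: fix1V|exact: fix1J]. Qed.
Lemma fix1X f n : fix1 f -> fix1 (f ^+ n).
Proof. by move=> f1 x; apply: autX_fix. Qed.

Lemma sectionM1 f g x : fix1 f -> section (f * g) [:: x] = section f [:: x] * section g [:: x].
Proof. by move=> f1; rewrite sectionM f1. Qed.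
Lemma sectionV1 f x : fix1 f -> section f^-1 [:: x] = (section f [:: x])^-1.
Proof. by move=> f1; rewrite sectionV autV_fix. Qed.
Lemma sectionJ f g u : f u = u -> section (f ^ g) (g u) = section f u ^ section g u.
Proof.
move=> fu; apply: (@mulgI _ (section g u)); rewrite -sectionM.
by rewrite conjgE mulVKg sectionM fu conjgE mulVKg.
Qed.
Lemma sectionJ1 f g x : fix1 f -> fix1 g ->
  section (f ^ g) [:: x] = section f [:: x] ^ section g [:: x].
Proof. by move=> f1 g1; rewrite -{1}(g1 x) sectionJ. Qed.
Lemma sectionR1 f g x : fix1 f -> fix1 g ->
  section [~ f, g] [:: x] = [~ section f [:: x], section g [:: x]].
Proof.
move=> f1 g1; rewrite !commgEl sectionM1; last exact: fix1V.
by rewrite sectionV1 // sectionJ1.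
Qed.
Lemma sectionX1 f n x : fix1 f -> section (f ^+ n) [:: x] = section f [:: x] ^+ n.
Proof.
move=> f1; elim: n => [|n IH]; first by rewrite section1.
by rewrite !expgS sectionM1 ?IH.
Qed.

Lemma label_rot_root : label a [::] = sigma p.
Proof. by apply/permP => x; have := aut1word a x; case. Qed.

Lemma section_rot x : section a [:: x] = 1.
Proof. by apply: tree_autP => v; apply: section_eq. Qed.

Lemma rotX_word k x v : (a ^+ k) (x :: v) = (sigma p ^+ k) x :: v.
Proof.
elim: k x => [|k IH] x; first by rewrite perm1.
by rewrite !expgS tree_autME IH permM.
Qed.

Lemma section_rotX k x : section (a ^+ k) [:: x] = 1.
Proof. by apply: tree_autP => v; apply: section_eq; rewrite /= !rotX_word. Qed.

Lemma rot_sylow : S a.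
Proof.
case=> [|x v]; first by rewrite label_rot_root cycle_id.
by rewrite -cat1s -label_section section_rot label1 group1.
Qed.

Lemma rotXp : a ^+ p = 1.
Proof.
apply: tree_autP => -[|x v]; first exact: aut_root.
rewrite rotX_word; congr (_ :: _); apply: (res_inj p_prime).
by rewrite res_sigmaX // pchar_Fp_0 // GRing.addr0.
Qed.

Lemma lab_exp_rot : lab_exp a [::] = 1%R.
Proof.
have [x x0] := res_surj p_prime 0%R.
have := lab_expP p_prime [::] x rot_sylow.
have := res_sigmaX p_prime 1 x; rewrite expg1 label_rot_root => ->.
by rewrite x0 !GRing.add0r => <-.
Qed.

Lemma lab_exp_rotX k : lab_exp (a ^+ k) [::] = k%:R%R.
Proof. by rewrite lab_expX_root // ?lab_exp_rot ?GRing.mul1r //; exact: rot_sylow. Qed.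

Lemma level_sum_rot n : level_sum n a = (n == 0%N)%:R%R.
Proof.
case: n => [|n] /=; first exact: lab_exp_rot.
by apply: big1 => x _; rewrite section_rot level_sum1.
Qed.

Lemma sectionJ_rot f k x : fix1 f ->
  section (f ^ (a ^+ k)) [:: (sigma p ^+ k) x] = section f [:: x].
Proof. by move=> f1; rewrite -rotX_word sectionJ // section_rotX conjg1. Qed.

Lemma sigma_trans x y : exists k, (sigma p ^+ k) x = y.
Proof.
pose k := (res y - res x : 'F_p)%R; exists (val k); apply: (res_inj p_prime).
by rewrite res_sigmaX // natr_Zp GRing.addrC GRing.subrK.
Qed.

Lemma derived_subgroup_is H : is_subgroup (derived_subgroup H).
Proof. exact: subgroup_genP. Qed.

Lemma derivedR H f g : H f -> H g -> derived_subgroup H [~ f, g].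
Proof. by move=> Hf Hg; rewrite /derived_subgroup; apply: sub_subgroup_gen; exists f, g. Qed.

Lemma derived_sub H N : is_subgroup N -> (forall f g, H f -> H g -> N [~ f, g]) ->
  derived_subgroup H `<=` N.
Proof. by move=> NN HN; apply: subgroup_gen_min => // _ [f [g [Hf Hg ->]]]; apply: HN. Qed.

Lemma derived_sub_self H : is_subgroup H -> derived_subgroup H `<=` H.
Proof. by move=> HH; apply: derived_sub => // f g; apply: subgroupR. Qed.

Lemma preimJ_subgroup H g : is_subgroup H -> is_subgroup [set f | H (f ^ g)].
Proof.
move=> HH; apply: subgroupP => /=; first by rewrite conj1g; apply: subgroup1.
  by move=> f h fH hH; rewrite conjMg; apply: subgroupM.
by move=> f fH; rewrite conjVg; apply: subgroupV.
Qed.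

Lemma derivedJ H g : (forall f, H f -> H (f ^ g)) ->
  forall f, derived_subgroup H f -> derived_subgroup H (f ^ g).
Proof.
move=> Hg; apply: (@derived_sub H [set f | derived_subgroup H (f ^ g)]).
  exact/preimJ_subgroup/derived_subgroup_is.
by move=> f h Hf Hh; rewrite /= conjRg; apply: derivedR; apply: Hg.
Qed.

(** For fixed f, the g with [f, g] in N form a subgroup because N is normalised; this is applied
    once in each argument of the commutator. *)
Lemma derived_gen_sub (A N : set (tree_aut p)) : is_subgroup N ->
  (forall f g, N f -> subgroup_gen A g -> N (f ^ g)) ->
  (forall f g, A f -> A g -> N [~ f, g]) -> derived_subgroup (subgroup_gen A) `<=` N.
Proof.
move=> NN NJ NA; set H := subgroup_gen A; have HH : is_subgroup H := subgroup_genP A.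
have CH f : is_subgroup [set g | H g /\ N [~ f, g]].
  apply: subgroupP => [|g h [Hg Ng] [Hh Nh]|g [Hg Ng]]; split=> /=.
  - exact: (subgroup1 HH).
  - by rewrite commg1; apply: subgroup1.
  - exact: (subgroupM HH Hg Hh).
  - by rewrite commgM_r; apply: subgroupM => //; apply: NJ.
  - exact: (subgroupV HH Hg).
  - have := commgM_r f g g^-1; rewrite mulgV commg1 => e.
    suff -> : [~ f, g^-1] = ([~ f, g]^-1) ^ g^-1.
      by apply: NJ; [exact: subgroupV|exact: (subgroupV HH Hg)].
    by apply: (@mulIg _ ([~ f, g] ^ g^-1)); rewrite -e -conjMg mulVg conj1g.
have NAH f g : A f -> H g -> N [~ f, g].
  move=> Af; suff /(_ g) : H `<=` [set g | H g /\ N [~ f, g]] by move=> sub /sub [].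
  by apply: subgroup_gen_min => // h Ah; split; [exact: sub_subgroup_gen|exact: NA].
apply: derived_sub => // f g Hf.
suff /(_ g) : H `<=` [set g | H g /\ N [~ f, g]] by move=> sub /sub [].
apply: subgroup_gen_min => // h Ah; split; first exact: sub_subgroup_gen.
by rewrite -invgR; apply: subgroupV => //; apply: NAH.
Qed.

End FirstLevel.

(** * Branching of the group generated by a and a directed automorphism *)

Section Directed.
Set Implicit Arguments.
Unset Strict Implicit.
Local Open Scope group_scope.
Variable p : nat.
Hypotheses (p_prime : prime p) (p_odd : odd p).
Implicit Types (f g h c : tree_aut p) (u v w : word p) (x y : 'I_p) (G H N : set (tree_aut p)).
Notation S := (@sylow_S p).
Notation a := (@rot_a p).
Variables (b : tree_aut p) (x0 : 'I_p).
Hypotheses (bS : S b) (b1 : fix1 b) (bx0 : section b [:: x0] = b).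
Hypothesis bx : forall x, x != x0 -> section b [:: x] = a ^+ (lab_exp b [:: x]).
Hypothesis level_sum_b_neq0 : level_sum 1 b <> 0%R.

Lemma lab_exp_b_root : lab_exp b [::] = 0%R.
Proof. exact: (lab_exp_root0 p_prime bS (b1 x0)). Qed.

Lemma lab_exp_b_x0 : lab_exp b [:: x0] = 0%R.
Proof. by have := lab_exp_section b [:: x0] [::]; rewrite bx0 lab_exp_b_root cats0 => <-. Qed.

(** Powers of a have sum zero below the root, so from level 2 on only the section b at x0
    contributes, and the sum is the same on every positive level. *)
Lemma level_sum_b n : level_sum n b = (if n is 0 then 0 else level_sum 1 b)%R.
Proof.
elim: n => [|[|n] IH] //; first exact: lab_exp_b_root.
rewrite -[LHS]/(\sum_(x < p) level_sum n.+1 (section b [:: x]))%R.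
rewrite (bigD1 x0) // bx0 IH big1; first exact: GRing.addr0.
move=> x /bx ->; rewrite level_sumX //; last exact: rot_sylow.
by rewrite level_sum_rot // GRing.mul0rn.
Qed.

(** The sum at the root comes from a and equals 1; on every deeper level it comes from b. *)
Lemma odometer_ab : odometer (a * b).
Proof.
split=> [|n]; first exact/sylowM/bS/rot_sylow.
rewrite level_sumM //; last exact: rot_sylow.
rewrite level_sum_rot // level_sum_b; case: n => [|n]; last by rewrite GRing.add0r.
by rewrite GRing.addr0; apply/eqP/GRing.oner_neq0.
Qed.

Lemma bXp : b ^+ p = 1.
Proof.
apply: tree_autP => u; elim: u => [|x u IH]; first exact: aut_root.
rewrite powX_cons //; have [->|/bx ->] := eqVneq x x0; first by rewrite bx0 IH.
by rewrite -expgnA mulnC expgnA rotXp // expg1n.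
Qed.

Lemma exists_lab_exp_neq0 : exists2 x, x != x0 & lab_exp b [:: x] != 0%R.
Proof.
have [x /andP[]|nx] := pickP [pred x | (x != x0) && (lab_exp b [:: x] != 0%R)]; first by exists x.
case: level_sum_b_neq0; apply: big1 => x _; rewrite /= lab_exp_section cats0.
have [->|xx0] := eqVneq x x0; first exact: lab_exp_b_x0.
by have := nx x; rewrite /= xx0 /= => /negbFE/eqP.
Qed.

Definition ggs : set (tree_aut p) := subgroup_gen [set a; b].
Notation D := (derived_subgroup ggs).
Notation K := (derived_subgroup D).

Lemma ggs_group : is_subgroup ggs. Proof. exact: subgroup_genP. Qed.
Lemma ggs_a : ggs a. Proof. by apply: sub_subgroup_gen; left. Qed.
Lemma ggs_b : ggs b. Proof. by apply: sub_subgroup_gen; right. Qed.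
Lemma ggs_aX k : ggs (a ^+ k). Proof. exact: subgroupX ggs_group ggs_a. Qed.
Lemma ggs_bJ k : ggs (b ^ (a ^+ k)).
Proof. exact: subgroupJ ggs_group ggs_b (ggs_aX k). Qed.

Lemma ggs_sylow : ggs `<=` S.
Proof.
apply: subgroup_gen_min; first exact: sylow_S_subgroup.
by move=> _ [->|->]; [exact: rot_sylow|exact: bS].
Qed.

Lemma ggs'_group : is_subgroup D. Proof. exact: subgroup_genP. Qed.
Lemma ggs''_group : is_subgroup K. Proof. exact: subgroup_genP. Qed.
Lemma ggs'_sub : D `<=` ggs. Proof. exact: (derived_sub_self ggs_group). Qed.
Lemma ggs''_sub : K `<=` D. Proof. exact: (derived_sub_self ggs'_group). Qed.
Lemma ggs'J f g : D f -> ggs g -> D (f ^ g).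
Proof.
move=> Df Gg; apply: (derivedJ (H := ggs)) => // h Gh; exact: subgroupJ ggs_group Gh Gg.
Qed.
Lemma ggs''J f g : K f -> ggs g -> K (f ^ g).
Proof. by move=> Kf Gg; apply: (derivedJ (H := D)) => // h Dh; apply: ggs'J. Qed.

(** Both generators are reached: b is its own section at x0, and a conjugate of b by a power of a
    has there a nontrivial power of a, from which a is recovered. *)
Lemma stab_onto g : ggs g -> exists h, [/\ ggs h, fix1 h & section h [:: x0] = g].
Proof.
suff /(_ g) : ggs `<=` [set g | exists h, [/\ ggs h, fix1 h & section h [:: x0] = g]] by [].
apply: subgroup_gen_min.
  apply: subgroupP => /=.
  - by exists 1; split; [exact: subgroup1 ggs_group|exact: fix1_1|exact: section1].
  - move=> f1 f2 [h1 [Gh1 fh1 <-]] [h2 [Gh2 fh2 <-]]; exists (h1 * h2); split.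
    + exact: subgroupM ggs_group Gh1 Gh2.
    + exact: fix1M.
    + by rewrite sectionM1.
  - move=> f [h [Gh fh <-]]; exists h^-1; split.
    + exact: subgroupV ggs_group Gh.
    + exact: fix1V.
    + by rewrite sectionV1.
move=> _ [->|->]; last by exists b; split=> //; exact: ggs_b.
have [x xx0 nz] := exists_lab_exp_neq0; have [k ek] := sigma_trans p_prime x x0.
(* The inverse modulo p of the exponent of b at x, turning that power of a back into a. *)
pose n : nat := (lab_exp b [:: x])^-1%R.
exists ((b ^ (a ^+ k)) ^+ n); split.
- exact: subgroupX ggs_group (ggs_bJ k).
- exact/fix1X/fix1J.
rewrite sectionX1; last exact: fix1J.
rewrite -ek sectionJ_rot // bx // -expgnA (expg_modn _ (rotXp p_prime)).
suff -> : (nat_of_ord (lab_exp b [:: x]) * n = 1 %[mod p])%N by rewrite modn_small ?prime_gt1.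
rewrite -!(val_Fp_nat p_prime) GRing.natrM !natr_Zp GRing.divff //.
Qed.

(* The projections to x0 of the elements of D supported on the subtrees at x0 and
   j. When this set contains D for two letters j, commutators of such elements
   yield every generator of K at x0 alone. *)
Definition two_point j : set (tree_aut p) := [set d | exists f,
  [/\ D f, fix1 f, section f [:: x0] = d &
      forall x, x != x0 -> x != j -> section f [:: x] = 1]].

Lemma two_point_group j : is_subgroup (two_point j).
Proof.
apply: subgroupP => /=.
- exists 1; split; [exact: subgroup1 ggs'_group|exact: fix1_1|exact: section1|].
  by move=> x _ _; exact: section1.
- move=> f1 f2 [h1 [Gh1 fh1 <- s1]] [h2 [Gh2 fh2 <- s2]]; exists (h1 * h2); split.
  + exact: subgroupM ggs'_group Gh1 Gh2.
  + exact: fix1M.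
  + by rewrite sectionM1.
  + by move=> x xx0 xj; rewrite sectionM1 // s1 // s2 // mulg1.
- move=> f [h [Gh fh <- s1]]; exists h^-1; split.
  + exact: subgroupV ggs'_group Gh.
  + exact: fix1V.
  + by rewrite sectionV1.
  + by move=> x xx0 xj; rewrite sectionV1 // s1 // invg1.
Qed.

Lemma two_pointJ j d g : two_point j d -> ggs g -> two_point j (d ^ g).
Proof.
move=> [f [Df f1 <- fs]] /stab_onto[h [Gh h1 <-]]; exists (f ^ h); split.
- exact: ggs'J.
- exact: fix1J.
- by rewrite sectionJ1.
- by move=> x xx0 xj; rewrite sectionJ1 // fs // conj1g.
Qed.

(** The set is normal in the group by [stab_onto], a is a power of a^k, and modulo [b, a] the two
    generators commute. *)
Lemma two_point_D j (k : 'F_p) : k != 0%R -> two_point j [~ b, a ^+ k] ->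
  D `<=` two_point j.
Proof.
move=> k0 bak; have MG := two_point_group j.
have Mt t : two_point j [~ b, (a ^+ k) ^+ t].
  elim: t => [|t IH]; first by rewrite commg1; apply: subgroup1.
  rewrite expgS commgM_r; apply: subgroupM => //; apply: two_pointJ => //.
  exact: subgroupX ggs_group (ggs_aX k).
have ba : two_point j [~ b, a].
  pose n : nat := (k^-1 : 'F_p)%R.
  suff -> : a = (a ^+ k) ^+ n by exact: Mt.
  rewrite -expgnA [RHS](expg_modn _ (rotXp p_prime)).
  suff -> : (nat_of_ord k * n %% p)%N = 1%N by [].
  by rewrite -(val_Fp_nat p_prime) GRing.natrM !natr_Zp GRing.divff // val_Fp_nat // modn_small ?prime_gt1.
apply: derived_gen_sub => //; first exact: two_pointJ.
move=> _ _ [->|->] [->|->]; rewrite ?commgg; try exact: subgroup1.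
  by rewrite -invgR; apply: subgroupV.
by [].
Qed.

(** The two factors have a section other than a power of a only at x0 and at y respectively; at all
    other letters powers of a commute. *)
Lemma commutator_two_point x y k :
  (sigma p ^+ k) x = x0 -> (sigma p ^+ k) x0 = y -> x != x0 ->
  let f := [~ b, b ^ (a ^+ k)] in
  [/\ D f, fix1 f, section f [:: x0] = [~ b, a ^+ (lab_exp b [:: x])],
      section f [:: y] = [~ a ^+ (lab_exp b [:: y]), b] &
      forall z, z != x0 -> z != y -> section f [:: z] = 1].
Proof.
move=> kx ky xx0 f; have bJ1 : fix1 (b ^ (a ^+ k)) by apply: fix1J.
have yx0 : y != x0.
  by apply: contra_neq xx0 => e; apply: (@perm_inj _ (sigma p ^+ k)); rewrite kx ky.
split.
- by apply: derivedR; [exact: ggs_b|exact: ggs_bJ].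
- exact: fix1R.
- by rewrite /f sectionR1 // bx0; have := sectionJ_rot k x b1; rewrite kx (bx xx0) => ->.
- by rewrite /f sectionR1 // (bx yx0); have := sectionJ_rot k x0 b1; rewrite ky bx0 => ->.
move=> z zx0 zy; rewrite /f sectionR1 // (bx zx0).
have [z' ez] : exists z', (sigma p ^+ k) z' = z by exists ((sigma p ^+ k)^-1 z); rewrite permKV.
have z'x0 : z' != x0 by apply: contra_neq zy => e; rewrite -ez e.
have := sectionJ_rot k z' b1; rewrite ez (bx z'x0) => ->.
by apply/eqP/commgP; apply: commuteX2.
Qed.

(* x and y lie opposite to each other about x0. If the exponent of b vanishes at y,
   the commutator attached to x is already supported at x0 alone. *)
Lemma opposite_points : exists x y,
  [/\ x != x0, y != x0, x != y, D `<=` two_point x & D `<=` two_point y].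
Proof.
have [x xx0 xnz] := exists_lab_exp_neq0.
have [k kx] := sigma_trans p_prime x x0; pose y := (sigma p ^+ k) x0.
have [l ly] := sigma_trans p_prime y x0.
have kr : (res x0 = res x + k%:R :> 'F_p)%R by rewrite -kx res_sigmaX.
have yr : (res y = res x0 + k%:R :> 'F_p)%R by rewrite res_sigmaX.
have lr : (res y + l%:R = res x0 :> 'F_p)%R by rewrite -[in RHS]ly res_sigmaX.
have lx : (sigma p ^+ l) x0 = x.
  apply: (res_inj p_prime); rewrite res_sigmaX //; apply: (@GRing.addIr _ k%:R%R).
  by rewrite -kr GRing.addrAC -yr.
have yx0 : y != x0.
  by apply: contra_neq xx0 => e; apply: (@perm_inj _ (sigma p ^+ k)); rewrite kx.
(* In F_p the letters are x = x0 - k and y = x0 + k; they differ because 2k is nonzero for odd p. *)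
have xy : x != y.
  apply: contra_neq xx0 => e; move: yr; rewrite -e kr -GRing.addrA => /esym/eqP.
  rewrite -[X in _ == X]GRing.addr0 (inj_eq (GRing.addrI _)) -GRing.natrD addnn -mul2n.
  rewrite -(GRing.dvdn_pcharf (pchar_Fp p_prime)) Gauss_dvdr ?coprimen2 //.
  rewrite (GRing.dvdn_pcharf (pchar_Fp p_prime)) => /eqP k0.
  by apply: (res_inj p_prime); rewrite kr k0 GRing.addr0.
have [Df f1 fx0 fy fz] := commutator_two_point kx erefl xx0.
exists x, y; split => //; last first.
  by apply: (two_point_D xnz); exists [~ b, b ^ (a ^+ k)].
have [ey|ey] := eqVneq (lab_exp b [:: y]) 0%R.
  apply: (two_point_D xnz); exists [~ b, b ^ (a ^+ k)]; split=> // z zx0 zx.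
  have [->|zy] := eqVneq z y; last exact: fz.
  by rewrite fy ey comm1g.
have [Dg g1 gx0 gy gz] := commutator_two_point ly lx yx0.
by apply: (two_point_D ey); exists [~ b, b ^ (a ^+ l)].
Qed.

Lemma sigma_invariant (T : Type) (F : 'I_p -> T) (t : 'F_p) : t != 0%R ->
  (forall y, F ((sigma p ^+ t) y) = F y) -> forall y z, F y = F z.
Proof.
move=> t0 Ft y z; pose i := ((res z - res y) / t : 'F_p)%R.
have -> : z = (sigma p ^+ (t * i)%N) y.
  apply: (res_inj p_prime); rewrite res_sigmaX // GRing.natrM !natr_Zp GRing.mulrC.
  by rewrite GRing.divfK // GRing.addrC GRing.subrK.
elim: (nat_of_ord i) => [|j IH]; first by rewrite muln0 perm1.
by rewrite mulnS addnC expgnDr permM Ft.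
Qed.

Lemma sum_res : (\sum_(y < p) res y = 0)%R.
Proof.
rewrite -GRing.natr_sum -(big_mkord xpredT (fun i => i)) bin2_sum.
apply/eqP; rewrite -(GRing.dvdn_pcharf (pchar_Fp p_prime)) prime_dvd_bin //=.
by rewrite ltn_neqAle prime_gt1 // andbT; apply: contraTneq p_odd => <-.
Qed.

Definition placed x d f := fix1 f /\ forall y, section f [:: y] = if y == x then d else 1.

(** A commutator of elements of D supported at {x0, x1} and at {x0, x2} has only its section at x0
    left. Conjugation by a power of a then moves it from x0 to x. *)
Lemma ggs''_placed x d : K d -> exists2 f, K f & placed x d f.
Proof.
move=> Kd; suff [f Kf [f1 fs]] : exists2 f, K f & placed x0 d f.
  have [k kx] := sigma_trans p_prime x0 x; exists (f ^ (a ^+ k)).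
    exact: ggs''J Kf (ggs_aX k).
  split=> [|y]; first exact: fix1J.
  have ey : y = (sigma p ^+ k) ((sigma p ^+ k)^-1 y) by rewrite permKV.
  rewrite {1}ey sectionJ_rot // fs (can2_eq (permKV _) (permK _)) kx //.
suff /(_ d Kd) : K `<=` [set d | exists2 f, K f & placed x0 d f] by [].
have [x1 [x2 [x1x0 x2x0 x12 D1 D2]]] := opposite_points.
apply: derived_sub.
  apply: subgroupP => /=.
  - exists 1; first exact: subgroup1 ggs''_group.
    by split=> // y; rewrite section1; case: ifP.
  - move=> d1 d2 [f1 Kf1 [f11 s1]] [f2 Kf2 [f21 s2]]; exists (f1 * f2).
      exact: subgroupM ggs''_group Kf1 Kf2.
    split; first exact: fix1M.
    by move=> y; rewrite sectionM1 // s1 s2; case: ifP; rewrite ?mulg1.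
  - move=> d1 [f Kf [f1 s1]]; exists f^-1; first exact: subgroupV ggs''_group Kf.
    split; first exact: fix1V.
    by move=> y; rewrite sectionV1 // s1; case: ifP; rewrite ?invg1.
move=> d1 d2 /D1[f1 [Df1 f11 <- s1]] /D2[f2 [Df2 f21 <- s2]].
exists [~ f1, f2]; first exact: derivedR.
split=> [|y]; first exact: fix1R.
rewrite sectionR1 //; have [->//|yx0] := eqVneq y x0.
have [->|yx1] := eqVneq y x1; first by rewrite (s2 _ x1x0 x12) commg1.
by rewrite s1 // comm1g.
Qed.

(* Otherwise the exponents of b on the first level would form an affine function of
   the letter, and their sum would be zero as p is odd. *)
Lemma ggs''_neq1 : exists2 f, K f & f <> 1.
Proof.
have [x xx0 xnz] := exists_lab_exp_neq0.
have [k kx] := sigma_trans p_prime x x0.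
have [Df f1 fx0 _ _] := commutator_two_point kx erefl xx0.
set f := [~ b, _] in Df f1 fx0; set d := [~ b, _] in fx0.
pose h := b^-1 * b ^ (a ^+ k).
have Dh : D h by rewrite -[h]/([~ b, a ^+ k]); apply: derivedR; [exact: ggs_b|exact: ggs_aX].
have bJ1 : fix1 (b ^ (a ^+ k)) by apply: fix1J.
have h1 : fix1 h by apply: fix1M; [exact: fix1V|].
exists [~ f, h]; first exact: derivedR.
move/eqP/commgP/commute_sym; rewrite /commute => e.
have hx0 : section h [:: x0] = b^-1 * a ^+ (lab_exp b [:: x]).
  rewrite /h sectionM1; last exact: fix1V.
  by rewrite sectionV1 // bx0; have := sectionJ_rot k x b1; rewrite kx (bx xx0) => ->.
(* If f and h commuted, so would their sections at x0. With t the exponent of b at x, this says that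
   d = [b, a^t] is invariant under conjugation by b^-1 a^t, which shifts the first level by t. *)
have {e} : d ^ (b^-1 * a ^+ (lab_exp b [:: x])) = d.
  rewrite -fx0 -hx0 -sectionJ1 //; congr (section _ _).
  by rewrite conjgE -e mulKg.
set c := _ * a ^+ _; set t := lab_exp b [:: x] in c d fx0 xnz * => dc.
have cS : S c by apply: sylowM; [exact: sylowV|exact/sylowX/rot_sylow].
have aS k' : S (a ^+ k') by apply/sylowX/rot_sylow.
have dS : S d by rewrite /d commgEl; apply: sylowM; [exact: sylowV|exact: sylowJ].
have d1 : fix1 d by apply: fix1M; [exact: fix1V|exact: fix1J].
have c_act y : c [:: y] = [:: (sigma p ^+ t) y].
  by rewrite /c tree_autME fix1V // rotX_word.
pose sh y := (sigma p ^+ t) y.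
have dcon y : lab_exp d [:: sh y] = lab_exp d [:: y] by rewrite -{1}dc -c_act lab_expJ.
have d_ex y : lab_exp d [:: sh y] = (lab_exp b [:: y] - lab_exp b [:: sh y])%R.
  rewrite /d commgEl lab_expM ?lab_expV //; [|exact: sylowV|exact: sylowJ].
  by rewrite autV_fix // GRing.addrC /sh -rotX_word lab_expJ.
(* The exponents of d are constant, so each shift by t lowers the exponent of b by one fixed amount;
   the linear term with slope r compensates for this. *)
pose r := (lab_exp d [:: x0] / t)%R; pose g y := (lab_exp b [:: y] + r * res y)%R.
have gc y : g y = g x0.
  apply: (sigma_invariant xnz) => z; rewrite /g res_sigmaX // natr_Zp GRing.mulrDr.
  rewrite GRing.divfK // -(sigma_invariant xnz dcon (sh z)) d_ex.
  by rewrite GRing.addrCA [X in (_ + X)%R]GRing.addrCA GRing.subrr GRing.addr0 GRing.addrC.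
apply: level_sum_b_neq0; rewrite /=.
under eq_bigr => y _ do rewrite lab_exp_section cats0.
have e y : lab_exp b [:: y] = (g x0 - r * res y)%R by rewrite -(gc y) GRing.addrK.
rewrite (eq_bigr _ (fun y _ => e y)) big_split /= GRing.sumr_const card_ord -GRing.mulr_natr.
rewrite pchar_Fp_0 // GRing.mulr0 GRing.add0r GRing.sumrN -GRing.mulr_sumr.
by rewrite sum_res // GRing.mulr0 GRing.oppr0.
Qed.

Lemma section_nil f : section f [::] = f.
Proof. by apply: tree_autP => v; apply: section_eq; rewrite aut_root. Qed.

(** Membership in the rigid stabiliser of the vertex w. *)
Definition supported f w := forall v, ~~ prefix w v -> f v = v.

Lemma ggs''_supported w d : K d -> exists2 f, K f & supported f w /\ section f w = d.
Proof.
move=> Kd; elim: w => [|x w [f Kf [fw fd]]]; first by exists d => //; split=> [v|]; [rewrite prefix0s|exact: section_nil].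
have [g Kg [g1 gs]] := ggs''_placed x Kf; exists g => //; split.
  case=> [|y v]; first by rewrite aut_root.
  rewrite prefix_cons -cat1s sectionE g1 gs => /= nv; congr (_ :: _).
  by have [yx|//] := eqVneq y x; apply: fw; move: nv; rewrite yx eqxx.
by rewrite -cat1s -section_cat gs eqxx.
Qed.

Lemma ggs_weakly_branch w : exists f, [/\ ggs f, f <> 1 & supported f w].
Proof.
have [d Kd d1] := ggs''_neq1; have [f Kf [fs fd]] := ggs''_supported w Kd.
exists f; split=> //; first exact: (ggs'_sub (ggs''_sub Kf)).
by move=> f1; apply: d1; rewrite -fd f1 section1.
Qed.

End Directed.

(** * Level stabilisers are characteristic *)

Section Supports.
Set Implicit Arguments.
Unset Strict Implicit.
Local Open Scope group_scope.
Variable p : nat.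
Hypotheses (p_prime : prime p).
Implicit Types (f g h c : tree_aut p) (u v w : word p) (x y : 'I_p) (G H N : set (tree_aut p)).
Notation S := (@sylow_S p).

Lemma prefix_aut g u v : prefix (g u) (g v) = prefix u v.
Proof.
suff imp h s t : prefix s t -> prefix (h s) (h t).
  by apply/idP/idP => [/(imp g^-1)|/imp]; rewrite ?autVKE; apply.
by case/prefixP => t' ->; rewrite sectionE prefix_prefix.
Qed.

Lemma prefix_same_size u v w : size u = size v -> prefix u (v ++ w) = (u == v).
Proof. by move=> e; rewrite prefixE take_size_cat ?e // eq_sym. Qed.

Lemma supported_fix f w u : supported f w -> (size u <= size w)%N -> f u = u.
Proof.
move=> fw uw; case: (boolP (prefix w u)) => [/prefixP[v euv]|]; last exact: fw.
have uw' : u = w.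
  by move: uw; rewrite euv size_cat -[X in (_ <= X)%N]addn0 leq_add2l leqn0 => /nilP ->; rewrite cats0.
rewrite uw'; case: (boolP (prefix w (f w))) => [|/fw/aut_inj//].
by rewrite -[f w]cats0 prefix_same_size ?aut_size // cats0 => /eqP.
Qed.

Lemma supportedM f g w : supported f w -> supported g w -> supported (f * g) w.
Proof. by move=> fw gw v nv; rewrite tree_autME fw // gw. Qed.

Lemma supportedX f w n : supported f w -> supported (f ^+ n) w.
Proof. by move=> fw v nv; rewrite autX_fix // fw. Qed.

Lemma supportedJ f g w : supported f w -> supported (f ^ g) (g w).
Proof. by move=> fw v; rewrite -(autKVE g v) prefix_aut autJE => /fw ->. Qed.

Lemma supported_cat f w v : supported f (w ++ v) -> supported f w.
Proof.
move=> fw u nu; apply: fw; apply: contra nu => /prefixP[t ->].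
by rewrite -catA prefix_prefix.
Qed.

Lemma neq1_moves f : f <> 1 -> exists u, f u <> u.
Proof.
move=> f1; apply: contrapT => nex; apply: f1; apply: tree_autP => u.
by apply: contrapT => fu; apply: nex; exists u.
Qed.

Lemma supported_moves f w : supported f w -> f <> 1 -> exists v, f (w ++ v) <> w ++ v.
Proof.
move=> fw /neq1_moves[u fu]; have [/prefixP[v e]|/fw//] := boolP (prefix w u).
by exists v; rewrite -e.
Qed.

Lemma disjoint_commute f g u v : size u = size v -> u <> v ->
  supported f u -> supported g v -> commute f g.
Proof.
move=> uv nuv fu gv.
have dis t : prefix u t -> ~~ prefix v t.
  case/prefixP => t' ->; rewrite prefix_same_size //.
  by apply/eqP => e; apply: nuv.
have pf h s t : supported h s -> size s = size u -> prefix s (h t) = prefix s t.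
  by move=> hs su; rewrite -{1}(supported_fix hs (leqnn _)) prefix_aut.
apply: tree_autP => t; rewrite !tree_autME; have [ut|nut] := boolP (prefix u t).
  by rewrite !gv ?dis // pf.
rewrite (fu _ nut) fu //; apply: contra nut => /[dup] ugt /dis.
by rewrite pf // => /gv <-.
Qed.

End Supports.

(** * A commutation criterion for fixing level n *)

Section WeaklyBranch.
Set Implicit Arguments.
Unset Strict Implicit.
Local Open Scope group_scope.
Variable p : nat.
Hypotheses (p_prime : prime p) (p_odd : odd p).
Implicit Types (f g h c : tree_aut p) (u v w : word p).
Notation S := (@sylow_S p).
Variable G : set (tree_aut p).
Hypotheses (GG : is_subgroup G) (GS : G `<=` S).
Hypothesis weakly_branch : forall w, exists f, [/\ G f, f <> 1 & supported f w].
Variable c : tree_aut p.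
Hypotheses (Gc : G c) (co : odometer c).

Lemma prime_period f v i : f ^+ p = 1 -> f v <> v -> (0 < i < p)%N -> (f ^+ i) v <> v.
Proof.
move=> fp fv /andP[i0 ip] fi; apply: fv.
have iN : (i%:R != 0 :> 'F_p)%R.
  by rewrite -(GRing.dvdn_pcharf (pchar_Fp p_prime)) gtnNdvd.
have -> : f = (f ^+ i) ^+ (i%:R^-1 : 'F_p)%R.
  rewrite -expgnA (expg_modn _ fp) -(val_Fp_nat p_prime) GRing.natrM natr_Zp.
  by rewrite GRing.divff // (val_Fp_nat p_prime 1) modn_small ?prime_gt1.
exact: autX_fix.
Qed.

Lemma order_p_power f m : f <> 1 -> f ^+ (p ^ m) = 1 ->
  exists i, f ^+ (p ^ i) <> 1 /\ (f ^+ (p ^ i)) ^+ p = 1.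
Proof.
elim: m => [|m IH] f1 fm; first by case: f1; rewrite -[f]expg1.
have [/IH|n1] := pselect (f ^+ (p ^ m) = 1); first exact.
by exists m; rewrite -expgnA -expnSr.
Qed.

(** Induction on n: take r of order p below w moving a vertex z, and s below z with s^(p^n)
    nontrivial. On the subtree at z, (rs)^p acts as s, so rs has a nontrivial p^(n+1)-th power. *)
Lemma weakly_branch_pow n w : exists f, [/\ G f, f ^+ (p ^ n) <> 1 & supported f w].
Proof.
elim: n w => [|n IH] w; first exact: weakly_branch.
have [f [Gf f1 fw]] := weakly_branch w.
have [fn|] := pselect (f ^+ (p ^ n.+1) = 1); last by exists f.
have [i [r1 rp]] := order_p_power f1 fn.
set r := f ^+ (p ^ i) in r1 rp; have Gr : G r by apply: subgroupX.
have rw : supported r w by apply: supportedX.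
have [v rv] := supported_moves rw r1; set z := w ++ v in rv.
have [s [Gs s1 sz]] := IH z.
have [t st] := supported_moves (supportedX (p ^ n) sz) s1.
exists (r * s); split; first exact: subgroupM.
  rewrite expnS expgnA => e; apply: st; rewrite -[RHS]aut1E -e.
  (* The r-orbit of z has length p, so for fewer than p steps it does not return to z and s acts
     trivially. *)
  have rsi j t' : (j < p)%N -> ((r * s) ^+ j) (z ++ t') = (r ^+ j) (z ++ t').
    elim: j => [|j IHj] // jp; rewrite !expgSr !tree_autME IHj ?(ltnW jp) //.
    have <- : (r ^+ j.+1) (z ++ t') = r ((r ^+ j) (z ++ t')) by rewrite expgSr.
    apply: sz; rewrite sectionE prefix_same_size ?aut_size //.
    by apply/eqP => /esym; apply: prime_period rp rv _.
  have rsp t' : ((r * s) ^+ p) (z ++ t') = s (z ++ t').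
    have [q ep] : exists q, p = q.+1 by exists p.-1; rewrite prednK ?prime_gt0.
    have -> : (r * s) ^+ p = (r * s) ^+ q.+1 by rewrite -ep.
    rewrite expgSr tree_autME rsi -?ep // tree_autME.
    have <- : (r ^+ q.+1) (z ++ t') = r ((r ^+ q) (z ++ t')) by rewrite expgSr.
    by rewrite -ep rp.
  elim: (p ^ n)%N t => [|k IHk] t //; rewrite !expgS !tree_autME rsp.
  by rewrite sectionE (supported_fix sz (leqnn _)) IHk.
apply: supportedM => //; exact: supported_cat sz.
Qed.

Lemma pow_fix n f u : S f -> (size u <= n)%N -> (f ^+ (p ^ n)) u = u.
Proof. by move=> fS un; apply: level_stab_fix (pow_stab p_prime n fS) un. Qed.

(** Some odd power of f, namely a power of p, fixes u; together with f^2 fixing u this makes f fix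
    u. *)
Lemma no_swap f u : S f -> f (f u) = u -> f u = u.
Proof.
move=> fS ffu; have := pow_fix fS (leqnn (size u)).
set N := (p ^ size u)%N; have oN : odd N by rewrite oddX p_odd orbT.
have -> : N = (2 * N./2).+1 by rewrite -{1}(odd_double_half N) oN mul2n.
rewrite expgS tree_autME expgnA.
by rewrite autX_fix // expg2 !tree_autME ffu.
Qed.

(* If all these conjugates X ^ R and B commuted, where X and B move z and R is
   supported below z, then B would preserve the support of [~ X, R], which meets
   only the subtrees at z and X z: it would swap z and X z, although p is odd. *)
Lemma stab_noncommuting n g (x : tree_aut p) : level_stab G n g -> G x -> x ^+ (p ^ n) <> 1 ->
  exists r h, [/\ G r, G h &
    ~ commute ((x ^+ (p ^ n)) ^ (r ^+ (p ^ n))) ((x ^+ (p ^ n)) ^ (g * h ^+ (p ^ n)))].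
Proof.
set q := (p ^ n)%N => gn Gx; set X := x ^+ q => X1; apply: contrapT => ncom.
have com r h : G r -> G h -> commute (X ^ (r ^+ q)) (X ^ (g * h ^+ q)).
  by move=> Gr Gh; apply: contrapT => nc; apply: ncom; exists r, h.
have Gg : G g by case: gn.
have GX : G X by apply: subgroupX.
have [z Xz] := neq1_moves X1.
have nz : (n < size z)%N.
  by rewrite ltnNge; apply/negP => zn; apply: Xz; apply: pow_fix => //; apply: GS.
(* A power c^i brings g z back to z. As g fixes the prefix of z of length n, so does c^i, hence q
   divides i. Thus c^i is a q-th power, as the required form of the conjugator demands. *)
have [i ci] := odometer_trans p_prime co (aut_size g z).
have [j ij] : exists j, i = (j * q)%N.
  apply/dvdnP; have -> : q = (p ^ size (take n z))%N by rewrite size_takel // ltnW.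
  apply: (odometer_dvd p_prime co).
  have gu : g (take n z) = take n z by rewrite (level_stab_fix gn) // size_takel // ltnW.
  have e : z = take n z ++ drop n z by rewrite cat_take_drop.
  have := congr1 (take n) ci; rewrite e sectionE gu.
  have := aut_prefix (c ^+ i) (take n z) (section g (take n z) (drop n z)).
  rewrite size_takel ?(ltnW nz) // => ->.
  by rewrite take_cat size_takel ?(ltnW nz) // ltnn subnn take0 cats0.
have Gcj : G (c ^+ j) by apply: subgroupX.
pose B := X ^ (g * (c ^+ j) ^+ q).
have GB : G B by apply: subgroupJ => //; apply: subgroupM => //; apply: subgroupX.
have Bz : B z <> z.
  have cz : (g * (c ^+ j) ^+ q) z = z by rewrite tree_autME -expgnA -ij.
  have := autJE X (g * (c ^+ j) ^+ q) z; rewrite cz -/B => ->.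
  by rewrite -[X in _ <> X]cz => /aut_inj.
have [r0 [Gr0 R1]] := weakly_branch_pow n z; move=> /(supportedX q).
have : G (r0 ^+ q) by apply: subgroupX.
have : commute (X ^ (r0 ^+ q)) B by apply: com.
move: (r0 ^+ q) R1 => R R1 XRB GR Rz.
have XB : commute X B by have := com 1 (c ^+ j) (subgroup1 GG) Gcj; rewrite expg1n conjg1.
pose D := X^-1 * X ^ R.
have DB : commute D B.
  by apply: commute_sym; apply: commuteM; [apply: commuteV|]; exact: commute_sym.
have DE (y : word p) : D y = R (X (R^-1 (X^-1 y))) by [].
(* D is the commutator of X and R, a product of one factor supported below X z and one supported
   below z. *)
have Dfix (y : word p) : ~~ prefix z y -> ~~ prefix (X z) y -> D y = y.
  move=> nz1 nz2; have nz3 : ~~ prefix z (X^-1 y) by rewrite -(prefix_aut X) autKVE.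
  by rewrite DE (autV_fix (Rz _ nz3)) autKVE Rz.
have [t Rt] := supported_moves Rz R1.
have sX : size (X z) = size z by rewrite aut_size.
have D0 : D (z ++ t) <> z ++ t.
  have nz3 : ~~ prefix z (X^-1 (z ++ t)).
    by rewrite -(prefix_aut X) autKVE prefix_same_size //; exact/eqP.
  by rewrite DE (autV_fix (Rz _ nz3)) autKVE.
(* B commutes with D and so permutes the vertices moved by D; each image of z under a power of B
   must then be z or X z. *)
have Dmove k : D ((B ^+ k) (z ++ t)) <> (B ^+ k) (z ++ t).
  have e : D * B ^+ k = B ^+ k * D := commuteX k DB.
  by rewrite -tree_autME -e tree_autME => /aut_inj.
have Bk k : (B ^+ k) z = z \/ (B ^+ k) z = X z.
  have pre w : size w = size z -> prefix w ((B ^+ k) (z ++ t)) = (w == (B ^+ k) z).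
    by move=> sw; rewrite sectionE prefix_same_size // aut_size.
  have [/eqP|nz1] := boolP (z == (B ^+ k) z); first by left.
  have [/eqP|nz2] := boolP (X z == (B ^+ k) z); first by right.
  by case: (Dmove k); apply: Dfix; rewrite pre.
have B1 : B z = X z by have := Bk 1%N; rewrite expg1 => -[].
apply: Bz; apply: no_swap; first exact: GS.
have := Bk 2; rewrite expg2 tree_autME => -[] // B2.
by case: (Xz); rewrite -B1; apply: (@aut_inj _ B); rewrite B2.
Qed.

(** If g moved u on level n, take x below u with nontrivial q-th power X, q = p^n. Since q-th powers
    fix level n, the two conjugates of X live below the distinct vertices u and g u, so they commute
    for all r and h. *)
Lemma noncommuting_stab n g : G g ->
  (forall x, G x -> x ^+ (p ^ n) <> 1 -> exists r h, [/\ G r, G h &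
    ~ commute ((x ^+ (p ^ n)) ^ (r ^+ (p ^ n))) ((x ^+ (p ^ n)) ^ (g * h ^+ (p ^ n)))]) ->
  level_stab G n g.
Proof.
move=> Gg nc; split=> // u un; apply: contrapT => gu.
have [x [Gx x1 xu]] := weakly_branch_pow n u.
have [r [h [Gr Gh]]] := nc x Gx x1; apply.
have xu' := supportedX (p ^ n) xu.
apply: (@disjoint_commute _ _ _ u (g u)); rewrite ?aut_size //.
- exact: nesym.
- by have := supportedJ (g := r ^+ (p ^ n)) xu'; rewrite pow_fix ?un //; apply: GS.
- have := supportedJ (g := g * h ^+ (p ^ n)) xu'.
  by rewrite tree_autME pow_fix ?aut_size ?un //; apply: GS.
Qed.

End WeaklyBranch.

(** * Automorphisms acting on a chain of normal subgroups *)

Section Automorphisms.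
Set Implicit Arguments.
Unset Strict Implicit.
Local Open Scope group_scope.
Variable p : nat.
Implicit Types (f g h : tree_aut p) (H : set (tree_aut p)) (phi : tree_aut p -> tree_aut p).
Variable G : set (tree_aut p).
Hypotheses (GG : is_subgroup G).

Section Hom.
Variable phi : tree_aut p -> tree_aut p.
Hypothesis phi_aut : group_automorphism G phi.

Lemma gaut_in f : G f -> G (phi f).
Proof. by case: phi_aut => -[+ _ _] _ => /(_ f). Qed.
Lemma gaut_inj f g : G f -> G g -> phi f = phi g -> f = g.
Proof. by case: phi_aut => -[_ + _] _ => /(_ f g); rewrite !inE. Qed.
Lemma gaut_surj g : G g -> exists2 f, G f & phi f = g.
Proof. by case: phi_aut => -[_ _ +] _ => /(_ g). Qed.
Lemma gautM f g : G f -> G g -> phi (f * g) = phi f * phi g.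
Proof. by case: phi_aut => _; apply. Qed.
Lemma gaut1 : phi 1 = 1.
Proof.
have G1 := subgroup1 GG; apply: (@mulgI _ (phi 1)).
by rewrite -gautM // !mulg1.
Qed.
Lemma gautV f : G f -> phi f^-1 = (phi f)^-1.
Proof.
move=> Gf; apply: (@mulgI _ (phi f)); rewrite -gautM ?mulgV ?gaut1 //.
exact: subgroupV.
Qed.
Lemma gautX f n : G f -> phi (f ^+ n) = phi f ^+ n.
Proof.
move=> Gf; elim: n => [|n IH]; first exact: gaut1.
by rewrite !expgS gautM ?IH //; apply: subgroupX.
Qed.
Lemma gautJ f g : G f -> G g -> phi (f ^ g) = phi f ^ phi g.
Proof.
move=> Gf Gg; rewrite !conjgE gautM ?gautM ?gautV //; first exact: subgroupV.
exact: subgroupM.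
Qed.

Lemma gaut_inverse : exists2 phi', group_automorphism G phi' &
  (forall f, G f -> phi' (phi f) = f) /\ (forall f, G f -> phi (phi' f) = f).
Proof.
have [phi' phi'P] : {phi' & forall g, G g -> G (phi' g) /\ phi (phi' g) = g}.
  apply: (@choice _ _ (fun g f => G g -> G f /\ phi f = g)) => g.
  by have [/gaut_surj[f Gf <-]|ng] := pselect (G g); [exists f|exists g].
have K1 f : G f -> phi (phi' f) = f by case/phi'P.
have K2 f : G f -> phi' (phi f) = f.
  by move=> Gf; have [Gf' e] := phi'P _ (gaut_in Gf); apply: gaut_inj.
exists phi' => //; split; [split=> [f /phi'P[]//|f g|f Gf]|move=> f g Gf Gg].
- by rewrite !inE => Gf Gg e; rewrite -(K1 f) // -(K1 g) // e.
- by exists (phi f); [exact: gaut_in|exact: K2].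
have [Gf' ef] := phi'P f Gf; have [Gg' eg] := phi'P g Gg.
apply: gaut_inj; [|exact: subgroupM|].
  by have [] := phi'P _ (subgroupM GG Gf Gg).
by rewrite gautM // ef eg K1 //; apply: subgroupM.
Qed.

Lemma image_normal H : normal_in H G -> normal_in (phi @` H) G.
Proof.
move=> [HH HG HJ]; split.
- apply: subgroupP => [|_ _ [f Hf <-] [g Hg <-]|_ [f Hf <-]].
  + by exists 1; [exact: subgroup1|exact: gaut1].
  + by exists (f * g); [exact: subgroupM|rewrite gautM //; apply: HG].
  + by exists f^-1; [exact: subgroupV|rewrite gautV //; apply: HG].
- by move=> _ [f Hf <-]; apply/gaut_in/HG.
- move=> _ g [f Hf <-] /gaut_surj[h Gh <-]; exists (f ^ h); first exact: HJ.
  by rewrite gautJ //; apply: HG.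
Qed.

End Hom.

(** An automorphism phi fixing both ends sends members of the chain to members and preserves strict
    inclusion, so the image of N_j is some N_i with i >= j. The same bound for the inverse of phi
    forces equality. *)
Lemma characteristic_chain (N : nat -> set (tree_aut p)) t A B :
  (forall phi, group_automorphism G phi -> phi @` A = A /\ phi @` B = B) ->
  (forall j, (j < t)%N -> N j `<` N j.+1) ->
  (forall H, (normal_in H G /\ A `<=` H /\ H `<=` B) <-> (exists2 j, (j <= t)%N & H = N j)) ->
  forall j, (j <= t)%N -> characteristic_in (N j) G.
Proof.
move=> ABc Nlt Nnorm.
have Nle i j : (i <= j)%N -> (j <= t)%N -> N i `<=` N j.
  move=> ij; rewrite -(subnKC ij); elim: (j - i)%N => [|k IH] kt; first by rewrite addn0.
  rewrite addnS in kt *; apply: subset_trans (properW (Nlt _ kt)).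
  exact/IH/ltnW.
have NN j : (j <= t)%N -> normal_in (N j) G /\ A `<=` N j /\ N j `<=` B.
  by move=> jt; apply/Nnorm; exists j.
have im phi j : group_automorphism G phi -> (j <= t)%N ->
    exists i, [/\ (j <= i)%N, (i <= t)%N & phi @` N j = N i].
  move=> phia; have [Ac Bc] := ABc _ phia.
  (* Here [lab_exp] is a local name for the fact that images of members are members; it does not
     refer to label exponents. *)
  have lab_exp k : (k <= t)%N -> exists2 i, (i <= t)%N & phi @` N k = N i.
    move=> /NN[Nk [Ak kB]]; apply/Nnorm; split; first exact: image_normal.
    by rewrite -Ac -Bc; split; apply: image_subset.
  elim: j => [|j IH] jt; first by have [i it e] := lab_exp 0%N jt; exists i.
  have [i [ji it e]] := IH (ltnW jt); have [i' it' e'] := lab_exp _ jt.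
  exists i'; split=> //; rewrite ltnNge; apply/negP => i'j.
  have [_] := Nlt _ jt; apply => f Nf.
  have : (phi @` N j) (phi f).
    by rewrite e; apply: (Nle i') => //; [exact: leq_trans i'j ji|rewrite -e'; exists f].
  have [[_ NG _] _] := NN _ (ltnW jt); have [[_ NG' _] _] := NN _ jt.
  by move=> [g Ng /(gaut_inj phia (NG _ Ng) (NG' _ Nf)) <-].
have sub phi j : group_automorphism G phi -> (j <= t)%N -> N j `<=` phi @` N j.
  by move=> phia jt; have [i [ji it ->]] := im _ _ phia jt; apply: Nle.
move=> j jt; have [[Nj NG _] _] := NN _ jt; split=> // phi phia.
have [phi' phia' [K1 K2]] := gaut_inverse phia.
apply/seteqP; split; last exact: sub.
move=> _ [f Nf <-]; have [g Ng <-] := sub _ _ phia' jt f Nf.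
by rewrite K2 //; apply: NG.
Qed.

End Automorphisms.

Section LevelStabCharacteristic.
Set Implicit Arguments.
Unset Strict Implicit.
Local Open Scope group_scope.
Variable p : nat.
Hypotheses (p_prime : prime p) (p_odd : odd p).
Variable G : set (tree_aut p).
Hypotheses (GG : is_subgroup G) (GS : G `<=` @sylow_S p).
Hypothesis weakly_branch : forall w, exists f, [/\ G f, f <> 1 & supported f w].
Variable c : tree_aut p.
Hypotheses (Gc : G c) (co : odometer c).

(** The criterion mentions only powers, conjugates and commutation in G, all of which phi carries
    over. *)
Lemma aut_level_stab phi n g : group_automorphism G phi -> level_stab G n g ->
  level_stab G n (phi g).
Proof.
move=> phia gn; have Gg : G g by case: gn.
apply: (noncommuting_stab p_prime GG GS weakly_branch); first exact: gaut_in phia _ Gg.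
move=> _ /(gaut_surj phia)[x Gx <-]; rewrite -(gautX GG phia) // => x1.
have x1' : x ^+ (p ^ n) <> 1 by move=> e; apply: x1; rewrite e (gaut1 GG phia).
have [r [h [Gr Gh nc]]] := stab_noncommuting p_prime p_odd GG GS weakly_branch Gc co gn Gx x1'.
exists (phi r), (phi h); split; [exact: gaut_in phia _ Gr|exact: gaut_in phia _ Gh|].
have GX f : G f -> G (f ^+ (p ^ n)) by apply: subgroupX.
have GMX : G (g * h ^+ (p ^ n)) by apply: subgroupM => //; apply: GX.
have G1 : G ((x ^+ (p ^ n)) ^ (r ^+ (p ^ n))) by apply: subgroupJ => //; apply: GX.
have G2 : G ((x ^+ (p ^ n)) ^ (g * h ^+ (p ^ n))) by apply: subgroupJ => //; apply: GX.
have e1 : phi ((x ^+ (p ^ n)) ^ (r ^+ (p ^ n))) = phi (x ^+ (p ^ n)) ^ (phi r ^+ (p ^ n)).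
  by rewrite (gautJ GG phia (GX _ Gx) (GX _ Gr)) (gautX GG phia _ Gr).
have e2 : phi ((x ^+ (p ^ n)) ^ (g * h ^+ (p ^ n))) =
    phi (x ^+ (p ^ n)) ^ (phi g * phi h ^+ (p ^ n)).
  by rewrite (gautJ GG phia (GX _ Gx) GMX) (gautM phia Gg (GX _ Gh)) (gautX GG phia _ Gh).
rewrite -e1 -e2 /commute -(gautM phia G1 G2) -(gautM phia G2 G1) => e.
by apply: nc; apply: (gaut_inj phia _ _ e); apply: subgroupM.
Qed.

Lemma level_stab_image phi n : group_automorphism G phi ->
  phi @` level_stab G n = level_stab G n.
Proof.
move=> phia; have [phi' phia' [K1 K2]] := gaut_inverse GG phia.
apply/seteqP; split=> [_ [g gn <-]|g gn]; first exact: aut_level_stab.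
exists (phi' g); first exact: aut_level_stab.
by apply: K2; case: gn.
Qed.

End LevelStabCharacteristic.

(** * Layers *)

Section FiniteImages.
Set Implicit Arguments.
Unset Strict Implicit.
Local Open Scope group_scope.
Variable p : nat.
Implicit Types (f g h c : tree_aut p) (H K : set (tree_aut p)).

Definition values (T : finType) (f : tree_aut p -> T) H : {set T} :=
  [set t | `[< exists2 g, H g & f g = t >]].

Lemma valuesP (T : finType) (f : tree_aut p -> T) H t :
  reflect (exists2 g, H g & f g = t) (t \in values f H).
Proof. by rewrite inE; apply: asboolP. Qed.

(** Turns an index into a finite count: the fibres of f on H are exactly the left cosets of K. *)
Lemma gindex_card (T : finType) (f : tree_aut p -> T) H K :
  is_subgroup H -> K `<=` H ->
  (forall x y, H x -> H y -> (f x = f y <-> K (x^-1 * y))) ->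
  gindex H K = #|values f H|.
Proof.
move=> HH KH fK; rewrite /gindex.
pose F (t : T) := [set y | H y /\ f y = t].
have cosE g : H g -> [set g * h | h in K] = F (f g).
  move=> Hg; apply/seteqP; split=> [_ [h Kh <-]|y [Hy e]] /=.
    have Hgh : H (g * h) by apply: subgroupM => //; apply: KH.
    by split=> //; apply/esym/fK => //; rewrite mulKg.
  by exists (g^-1 * y); [apply/fK|rewrite mulVKg].
have -> : left_cosets H K = [set` [fset F t | t in values f H]%fset].
  apply/seteqP; split=> [_ [g Hg <-]|A /imfsetP[t /valuesP[g Hg <-] ->]].
    apply/imfsetP; exists (f g); last exact: cosE.
    by apply/valuesP; exists g.
  by exists g => //; apply: cosE.
rewrite set_fsetK card_in_imfset /=; first by rewrite -cardE.
move=> s t /valuesP[g Hg <-] /valuesP[h Hh <-] e.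
by have [] : F (f h) g by rewrite -e.
Qed.

Variable n : nat.

Lemma size_act g (t : n.-tuple 'I_p) : size (g t) == n.
Proof. by rewrite aut_size size_tuple. Qed.

Definition act g (t : n.-tuple 'I_p) : n.-tuple 'I_p := Tuple (size_act g t).

Lemma act_inj g : injective (act g).
Proof. by move=> s t /(congr1 val) /= /aut_inj/val_inj. Qed.

Definition perm_of g : {perm n.-tuple 'I_p} := perm (@act_inj g).

Lemma perm_ofE g t : perm_of g t = g t :> seq 'I_p.
Proof. by rewrite permE. Qed.

Lemma perm_ofM g h : perm_of (g * h) = perm_of g * perm_of h.
Proof. by apply/permP => t; apply: val_inj; rewrite permM /= !perm_ofE. Qed.

Lemma perm_of1 : perm_of 1 = 1.
Proof. by apply/permP => t; apply: val_inj; rewrite perm1 /= perm_ofE. Qed.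

Lemma perm_ofV g : perm_of g^-1 = (perm_of g)^-1.
Proof. by apply: (@mulgI _ (perm_of g)); rewrite -perm_ofM !mulgV perm_of1. Qed.

Lemma perm_ofX g k : perm_of (g ^+ k) = perm_of g ^+ k.
Proof. by elim: k => [|k IH]; rewrite ?perm_of1 // !expgS perm_ofM IH. Qed.

Lemma perm_ofJ g h : perm_of (g ^ h) = perm_of g ^ perm_of h.
Proof. by rewrite !conjgE !perm_ofM perm_ofV. Qed.

Lemma perm_of_eq1 G g : G g -> perm_of g = 1 <-> level_stab G n g.
Proof.
move=> Gg; split=> [/permP g1|[_ gn]].
  split=> // u /eqP un; have := congr1 val (g1 (Tuple un)).
  by rewrite /= perm_ofE perm1.
by apply/permP => t; apply: val_inj; rewrite perm1 /= perm_ofE gn ?size_tuple.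
Qed.

Lemma perm_of_eq G g h : is_subgroup G -> G g -> G h ->
  perm_of g = perm_of h <-> level_stab G n (g^-1 * h).
Proof.
move=> GG Gg Gh; rewrite -perm_of_eq1; last by apply: subgroupM => //; apply: subgroupV.
rewrite perm_ofM perm_ofV; split=> [->|/mulg1_eq]; first by rewrite mulVg.
by rewrite invgK.
Qed.

Lemma values_group_set H : is_subgroup H -> group_set (values perm_of H).
Proof.
move=> HH; apply/group_setP; split=> [|_ _ /valuesP[g Hg <-] /valuesP[h Hh <-]].
  by apply/valuesP; exists 1; [exact: subgroup1|exact: perm_of1].
by apply/valuesP; exists (g * h); [exact: subgroupM|exact: perm_ofM].
Qed.

Definition perm_image H (HH : is_subgroup H) : {group {perm n.-tuple 'I_p}} :=
  Group (values_group_set HH).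

Lemma perm_imageP H (HH : is_subgroup H) s :
  reflect (exists2 g, H g & perm_of g = s) (s \in perm_image HH).
Proof. exact: valuesP. Qed.

End FiniteImages.

(** * The chain of normal subgroups in a single layer *)

Section Layers.
Set Implicit Arguments.
Unset Strict Implicit.
Local Open Scope group_scope.
Variable p : nat.
Hypothesis p_prime : prime p.
Implicit Types (f g h : tree_aut p) (H K : set (tree_aut p)) (u v : word p).
Notation S := (@sylow_S p).

Lemma perm_of_lab_exp m g h : S g -> S h ->
  (forall u, size u = m -> g u = u) -> (forall u, size u = m -> h u = u) ->
  perm_of m.+1 g = perm_of m.+1 h <-> (forall u, size u = m -> lab_exp g u = lab_exp h u).
Proof.
move=> gS hS gm hm; split=> [e u um|e].
  have [x _] := res_surj p_prime 0%R.
  have sz : size (rcons u x) == m.+1 by rewrite size_rcons um.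
  have /(congr1 val) := congr1 (fun s : {perm m.+1.-tuple 'I_p} => s (Tuple sz)) e.
  rewrite /= !perm_ofE /= !labelE gm // hm // => /rcons_inj[/(congr1 (@res p))].
  by rewrite !lab_expP // => /GRing.addrI.
apply/permP => -[w]; case/lastP: w => // u x wm; apply: val_inj.
rewrite /= !perm_ofE /= !labelE; have um : size u = m.
  by move: wm; rewrite size_rcons => /eqP[].
rewrite gm // hm //; congr rcons; apply: (res_inj p_prime).
by rewrite !lab_expP // e.
Qed.

Variable G : set (tree_aut p).
Hypotheses (GG : is_subgroup G) (GS : G `<=` S).
Variable c : tree_aut p.
Hypotheses (Gc : G c) (co : odometer c).
Variable m : nat.

Let P := perm_image m.+1 GG.
Let V := perm_image m.+1 (level_stab_subgroup m GG).
Let c0 := perm_of m.+1 c.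

(** By Cauchy, a prime divisor of the order is the order of some element, while all p^(m+1)-th
    powers act trivially on level m+1. *)
Lemma image_pgroup : p.-group P.
Proof.
apply/pgroupP => q q_pr /(Cauchy q_pr)[s /perm_imageP[g Gg <-] o].
have : #[perm_of m.+1 g] %| p ^ m.+1.
  rewrite order_dvdn -perm_ofX; apply/eqP/(perm_of_eq1 _ (G := S)).
    exact/sylowX/GS.
  exact: pow_stab (GS Gg).
by rewrite o Euclid_dvdX // dvdn_prime2 // => /andP[/eqP-> _]; rewrite inE.
Qed.

Lemma stab_image_sub : V \subset P.
Proof.
apply/fintype.subsetP => _ /perm_imageP[g [Gg _] <-]; apply/perm_imageP; by exists g.
Qed.

Lemma stab_image_normal : V <| P.
Proof.
rewrite /normal stab_image_sub andTb; apply/fintype.subsetP => _ /perm_imageP[g Gg <-]; rewrite inE.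
apply/fintype.subsetP => _ /imsetP[_ /perm_imageP[f fV <-] ->].
by apply/perm_imageP; exists (f ^ g); [apply: level_stabJ | apply: perm_ofJ].
Qed.

Lemma stab_image_abelian : abelian V.
Proof.
apply/centsP => _ /perm_imageP[g [Gg gm] <-] _ /perm_imageP[h [Gh hm] <-].
have [gS hS] := (GS Gg, GS Gh).
rewrite /commute -!perm_ofM; apply/perm_of_lab_exp; rewrite ?tree_autME //; try exact: sylowM.
- by move=> u um; rewrite tree_autME gm ?hm.
- by move=> u um; rewrite tree_autME hm ?gm.
by move=> u um; rewrite !lab_expM // gm ?hm // GRing.addrC.
Qed.

Lemma odometer_image : c0 \in P. Proof. by apply/perm_imageP; exists c. Qed.

(** Commuting with c makes the exponents of g constant along c-orbits, and level m is a single
    orbit. *)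
Lemma lab_exp_centraliser g u v : level_stab G m g -> perm_of m.+1 g \in 'C[c0] ->
  size u = m -> size v = m -> lab_exp g u = lab_exp g v.
Proof.
move=> gm gc um vm; have gS : S g by apply: GS; case: gm.
have cS := GS Gc; have [_ gfix] := gm; have [_ gcfix] := level_stabJ GG gm Gc.
have step w : size w = m -> lab_exp g (c w) = lab_exp g w.
  move=> wm; have <- : lab_exp (g ^ c) (c w) = lab_exp g w by apply: lab_expJ => //; apply: gfix.
  symmetry; move: (c w) (aut_size c w) => w' ww'.
  have := perm_of_lab_exp (sylowJ gS cS) gS gcfix gfix; case=> + _; apply; last by rewrite ww'.
  by rewrite perm_ofJ; apply/conjg_fixP/commgP/cent1P.
have [i <-] := odometer_trans p_prime co (etrans um (esym vm)).
elim: i => [|i IH] //; rewrite expgSr tree_autME step // aut_size //.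
Qed.

(** A constant exponent is known from one vertex: evaluating at a single word of length m+1 injects
    the centraliser into the alphabet. *)
Lemma card_cent_stab_image : #|'C_V[c0]| <= p.
Proof.
have [x _] := res_surj p_prime 0%R; set u := nseq m x.
have um : size u = m by rewrite size_nseq.
have sz : size (rcons u x) == m.+1 by rewrite size_rcons um.
pose F (s : {perm m.+1.-tuple 'I_p}) : 'I_p := last x (s (Tuple sz)).
have Fg g : level_stab G m g -> F (perm_of m.+1 g) = label g u x.
  by move=> [_ gm]; rewrite /F perm_ofE /= labelE gm // last_rcons.
rewrite -(card_in_imset (f := F)); first by rewrite -[p in leqRHS]card_ord max_card.
move=> _ _ /setIP[/perm_imageP[g gm <-] gc] /setIP[/perm_imageP[h hm <-] hc].
rewrite !Fg // => /(congr1 (@res p)).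
have [Gg gfix] := gm; have [Gh hfix] := hm; have gS := GS Gg; have hS := GS Gh.
rewrite !lab_expP // => /GRing.addrI e; apply/(perm_of_lab_exp gS hS gfix hfix) => v vm.
by rewrite (lab_exp_centraliser gm gc vm um) (lab_exp_centraliser hm hc vm um).
Qed.

Lemma stab_image_uniserial (A B : {group {perm m.+1.-tuple 'I_p}}) :
  A \subset V -> B \subset V -> A <| P -> B <| P -> #|A| <= #|B| -> A \subset B.
Proof.
move=> AV BV /andP[_ nA] /andP[_ nB]; apply: (uniserial p_prime _ _ _ stab_image_abelian card_cent_stab_image) => //.
- exact: pgroupS stab_image_sub image_pgroup.
- exact: mem_p_elt image_pgroup odometer_image.
- by have /andP[_ nV] := stab_image_normal; apply: (fintype.subsetP nV); apply: odometer_image.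
- exact/(fintype.subsetP nA)/odometer_image.
- exact/(fintype.subsetP nB)/odometer_image.
Qed.

Lemma gindex_layer : gindex (level_stab G m) (level_stab G m.+1) = #|V|.
Proof.
apply: gindex_card; first exact: level_stab_subgroup.
  by move=> g; apply: level_stabS.
move=> x y [Gx _] [Gy _]; exact: perm_of_eq.
Qed.

Lemma layer_card : #|V| = (p ^ layer_length G m)%N.
Proof.
rewrite /layer_length gindex_layer.
have /p_natP[k ->] : p.-group V := pgroupS stab_image_sub image_pgroup.
by rewrite trunc_expnK ?prime_gt1.
Qed.

(** N_j is the preimage in G of a normal subgroup Q_j of P of order p^j inside V. Comparability by
    order makes Q_j the only such subgroup and the Q_j nested. *)
Lemma layer_chain : exists N : nat -> set (tree_aut p), let t := layer_length G m in
  [/\ gindex (level_stab G m) (level_stab G m.+1) = (p ^ t)%N,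
      N 0%N = level_stab G m.+1,
      N t = level_stab G m,
      forall j, (j < t)%N -> N j `<` N j.+1 /\ gindex (N j.+1) (N j) = p &
      forall H, (normal_in H G /\ level_stab G m.+1 `<=` H /\ H `<=` level_stab G m) <->
        (exists2 j, (j <= t)%N & H = N j)].
Proof.
set t := layer_length G m.
have pP := image_pgroup; have pV : p.-group V := pgroupS stab_image_sub pP.
have [Q QP] : {Q : nat -> {group {perm m.+1.-tuple 'I_p}} & forall j, (j <= t)%N ->
    [/\ Q j \subset V, Q j <| P & #|Q j| = (p ^ j)%N]}.
  apply: (@choice _ _ (fun j (A : {group {perm m.+1.-tuple 'I_p}}) => (j <= t)%N ->
    [/\ A \subset V, A <| P & #|A| = (p ^ j)%N])) => j.
  (* Beyond t the value [V] is an arbitrary default. *)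
  have [jt|] := boolP (j <= t)%N; last by exists V.
  have [|A [AV AP cA]] := normal_pgroup (r := j) pP stab_image_normal; last by exists A.
  by rewrite layer_card pfactorK.
pose N j := [set g | G g /\ perm_of m.+1 g \in Q j].
have NG j : is_subgroup (N j).
  apply: subgroupP => [|f g [Gf Qf] [Gg Qg]|f [Gf Qf]]; split.
  - exact: subgroup1.
  - by rewrite perm_of1 group1.
  - exact: subgroupM.
  - by rewrite perm_ofM groupM.
  - exact: subgroupV.
  - by rewrite perm_ofV groupV.
have Nsub j : (j <= t)%N -> level_stab G m.+1 `<=` N j /\ N j `<=` level_stab G m.
  move=> /QP[QV _ _]; split=> [g gm|g [Gg /(fintype.subsetP QV)/perm_imageP[h hm e]]].
    have Gg : G g by case: gm.
    by split=> //; have /(perm_of_eq1 _ Gg) -> := gm; rewrite group1.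
  have Gh : G h by case: hm.
  have /(perm_of_eq _ GG Gh Gg)/level_stabS hg := e.
  rewrite -(mulVKg h g); apply: subgroupM => //; first exact: level_stab_subgroup.
  exact: hg.
have Nsurj j s : (j <= t)%N -> s \in Q j -> exists2 g, N j g & perm_of m.+1 g = s.
  move=> /QP[QV _ _] sQ; have /perm_imageP[g [Gg _] e] := fintype.subsetP QV s sQ.
  by exists g => //; split=> //; rewrite e.
have Nnorm j : (j <= t)%N -> normal_in (N j) G.
  move=> /QP[_ /andP[_ QP'] _]; split=> // [g []//|h g [Gh Qh] Gg].
  split; first exact: subgroupJ.
  rewrite perm_ofJ memJ_norm //; apply: (fintype.subsetP QP').
  by apply/perm_imageP; exists g.
have uniq j (A : {group {perm m.+1.-tuple 'I_p}}) : (j <= t)%N -> A \subset V -> A <| P -> #|A| = (p ^ j)%N -> A = Q j :> {set _}.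
  move=> /QP[QV QP' cQ] AV AP cA.
  by apply/eqP; rewrite finset.eqEsubset; apply/andP; split; apply: stab_image_uniserial; rewrite ?cA ?cQ.
have QS j : (j < t)%N -> Q j \subset Q j.+1.
  move=> jt; have [QV QN cQ] := QP _ (ltnW jt); have [QV' QN' cQ'] := QP _ jt.
  by apply: stab_image_uniserial => //; rewrite cQ cQ' leq_exp2l ?prime_gt1.
exists N; split.
- by rewrite gindex_layer layer_card.
- have [_ _ c1] := QP 0%N (leq0n t).
  have Q1 : Q 0%N = 1 :> {set _} by apply: card1_trivg; rewrite c1.
  apply/seteqP; split=> [g [Gg]|]; last by case: (Nsub 0%N (leq0n t)).
  by rewrite Q1 => /finset.set1P /perm_of_eq1; apply.
- apply/seteqP; split; first by case: (Nsub _ (leqnn t)).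
  move=> g gm; have Gg : G g by case: gm.
  split=> //; rewrite -(uniq t V) ?leqnn ?stab_image_normal ?layer_card //.
  by apply/perm_imageP; exists g.
- move=> j jt; have [QV QN cQ] := QP _ (ltnW jt); have [QV' QN' cQ'] := QP _ jt.
  have NS : N j `<=` N j.+1 by move=> g [Gg Qg]; split=> //; apply: (fintype.subsetP (QS _ jt)).
  have idx : gindex (N j.+1) (N j) = p.
    rewrite (@gindex_card _ _ (fun g => perm_of m.+1 g *: Q j)) //.
      have -> : values (fun g => perm_of m.+1 g *: Q j) (N j.+1) = lcosets (Q j) (Q j.+1).
        apply/setP => A; apply/valuesP/lcosetsP => [[g [Gg Qg] <-]|[s sQ ->]].
          by exists (perm_of m.+1 g).
        by have [g Ng <-] := Nsurj _ _ jt sQ; exists g.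
      rewrite card_lcosets -divgS ?QS // cQ cQ' expnS mulnK // expn_gt0 prime_gt0 //.
    move=> x y [Gx _] [Gy _]; split=> [e|[_]].
      split; first by apply: subgroupM => //; apply: subgroupV.
      rewrite perm_ofM perm_ofV -mem_lcoset e; exact: lcoset_refl.
    by rewrite perm_ofM perm_ofV -mem_lcoset => /lcoset_eqP.
  split=> //; split=> // NSj.
  have e : N j.+1 = N j by apply/seteqP.
  have : Q j.+1 \subset Q j.
    apply/fintype.subsetP => s sQ; have [g Ng <-] := Nsurj _ _ jt sQ.
    by case: (NSj _ Ng).
  by move/subset_leq_card; rewrite cQ cQ' leq_exp2l ?prime_gt1 // ltnn.
- move=> H; split=> [[[HH HG HJ] [mH Hm]]|[j jt ->]]; last first.
    by have [] := Nsub _ jt; have := Nnorm _ jt.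
  pose A := perm_image m.+1 HH.
  have AV : A \subset V.
    by apply/fintype.subsetP => _ /perm_imageP[g Hg <-]; apply/perm_imageP; exists g => //; apply: Hm.
  have AP : A <| P.
    rewrite /normal (fintype.subset_trans AV stab_image_sub) andTb; apply/fintype.subsetP => _ /perm_imageP[g Gg <-].
    rewrite inE; apply/fintype.subsetP => _ /imsetP[_ /perm_imageP[h Hh <-] ->].
    by apply/perm_imageP; exists (h ^ g); [apply: HJ|apply: perm_ofJ].
  have /p_natP[j cA] : p.-group A := pgroupS AV pV.
  have jt : (j <= t)%N.
    by rewrite -(leq_exp2l j t (prime_gt1 p_prime)) -cA -layer_card subset_leq_card.
  exists j => //; apply/seteqP; split=> [g Hg|g [Gg]].
    by split; [exact: HG|rewrite -(uniq j A) //; apply/perm_imageP; exists g].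
  rewrite -(uniq j A) // => /perm_imageP[h Hh e].
  have /(perm_of_eq _ GG (HG _ Hh) Gg)/mH hg := e.
  by rewrite -(mulVKg h g); apply: subgroupM.
Qed.

End Layers.

(** * Counting layers by label vectors *)

Section LabelVectors.
Set Implicit Arguments.
Unset Strict Implicit.
Local Open Scope group_scope.
Variable p : nat.
Hypothesis p_prime : prime p.
Implicit Types (f g h : tree_aut p) (G H K : set (tree_aut p)) (u v : word p).
Notation S := (@sylow_S p).

Definition label_vector m g : {ffun m.-tuple 'I_p -> 'F_p} := [ffun u => lab_exp g (tval u)].

(** A model of St_H(m)/St_H(m+1) as a set of functions from level m to F_p. *)
Definition layer m H := values (label_vector m) (level_stab H m).

Lemma layerP m H (v : {ffun m.-tuple 'I_p -> 'F_p}) : reflect (exists2 g, level_stab H m g & label_vector m g = v) (v \in layer m H).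
Proof. exact: valuesP. Qed.

Lemma card_layer G m : is_subgroup G -> G `<=` S ->
  gindex (level_stab G m) (level_stab G m.+1) = #|layer m G|.
Proof.
move=> GG GS; apply: gindex_card; first exact: level_stab_subgroup.
  by move=> g; apply: level_stabS.
move=> x y [Gx xm] [Gy ym]; rewrite -(perm_of_eq _ GG Gx Gy).
have := perm_of_lab_exp p_prime (GS _ Gx) (GS _ Gy) xm ym; case=> e1 e2.
split=> [/ffunP e|/e1 e].
  by apply: e2 => u /eqP um; have := e (Tuple um); rewrite !ffunE.
by apply/ffunP => u; rewrite !ffunE e ?size_tuple.
Qed.

Definition split_vector m (v : {ffun m.+1.-tuple 'I_p -> 'F_p}) :
    {ffun 'I_p -> {ffun m.-tuple 'I_p -> 'F_p}} :=
  [ffun x : 'I_p => [ffun u : m.-tuple 'I_p => v [tuple of x :: u]]].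

Lemma split_vector_inj m : injective (@split_vector m).
Proof.
move=> v w /ffunP e; apply/ffunP => u; rewrite (tuple_eta u).
by have := e (thead u); rewrite !ffunE => /ffunP/(_ [tuple of behead u]); rewrite !ffunE.
Qed.

Lemma split_label_vector m g x :
  split_vector (label_vector m.+1 g) x = label_vector m (section g [:: x]).
Proof. by apply/ffunP => u; rewrite !ffunE lab_exp_section. Qed.

Lemma card_layer_le m H K :
  (forall g x, level_stab H m.+1 g -> level_stab K m (section g [:: x])) ->
  #|layer m.+1 H| <= #|layer m K| ^ p.
Proof.
move=> HK; have := card_ffun_on 'I_p (mem (layer m K)); rewrite card_ord => <-.
rewrite -(card_imset _ (@split_vector_inj m)).
apply/subset_leq_card/fintype.subsetP => _ /imsetP[_ /layerP[g gm <-] ->].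
apply/ffun_onP => x; rewrite split_label_vector; apply/layerP.
by exists (section g [:: x]) => //; apply: HK.
Qed.

Lemma card_layer_ge m H K :
  (forall k : 'I_p -> tree_aut p, (forall x, level_stab K m (k x)) ->
     exists2 g, level_stab H m.+1 g & forall x, section g [:: x] = k x) ->
  #|layer m K| ^ p <= #|layer m.+1 H|.
Proof.
move=> KH; have := card_ffun_on 'I_p (mem (layer m K)); rewrite card_ord => <-.
rewrite -(card_imset _ (@split_vector_inj m)).
apply/subset_leq_card/fintype.subsetP => v /ffun_onP vK.
have [k kP] : {k : 'I_p -> tree_aut p & forall x, level_stab K m (k x) /\ label_vector m (k x) = v x}.
  apply: (@choice _ _ (fun x f => level_stab K m f /\ label_vector m f = v x)) => x.
  by have /layerP[f fK <-] := vK x; exists f.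
have [|g gm gk] := KH k; first by move=> x; case: (kP x).
apply/imsetP; exists (label_vector m.+1 g); first by apply/layerP; exists g.
by apply/ffunP => x; rewrite split_label_vector gk; case: (kP x).
Qed.

Lemma section_level_stab G m g x : self_similar G -> level_stab G m.+1 g ->
  level_stab G m (section g [:: x]).
Proof.
move=> Gsim gm; have gx : g [:: x] = [:: x] by apply: (level_stab_fix gm).
split; first by apply: Gsim => //; case: gm.
move=> u um; apply: section_eq; rewrite gx (level_stab_fix gm) //= um //.
Qed.

End LabelVectors.

Section ZeroSum.
Local Open Scope ring_scope.

(** Every function is uniquely a zero-sum function plus a multiple of the indicator of t0. *)
Lemma card_zero_sum (p : nat) (T : finType) (t0 : T) : prime p ->
  (#|[set v : {ffun T -> 'F_p} | (\sum_t v t == 0)%R]%SET| * p)%N = (p ^ #|T|)%N.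
Proof.
move=> p_prime; set Z := [set v | _]%SET.
pose f (vk : {ffun T -> 'F_p} * 'F_p) : {ffun T -> 'F_p} :=
  [ffun t => vk.1 t + (t == t0)%:R * vk.2].
have fsum vk : \sum_t f vk t = \sum_t vk.1 t + vk.2.
  rewrite (eq_bigr _ (fun t _ => ffunE _ t)) big_split /=; congr (_ + _).
  rewrite (bigD1 t0) //= eqxx GRing.mul1r big1 ?GRing.addr0 // => t /negPf ->; exact: GRing.mul0r.
have -> : (p ^ #|T|)%N = #|[set: {ffun T -> 'F_p}]%SET| by rewrite cardsT card_ffun card_Fp.
have -> : [set: {ffun T -> 'F_p}]%SET = f @: finset.setX Z [set: 'F_p]%SET.
  apply/setP => w; rewrite inE; apply/esym/imsetP.
  pose k := \sum_t w t; exists ([ffun t => w t - (t == t0)%:R * k], k).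
    rewrite inE /= !inE andbT; under eq_bigr do rewrite ffunE.
    rewrite big_split /= GRing.sumrN.
    rewrite [X in _ - X](bigD1 t0) //= eqxx GRing.mul1r [X in _ - (_ + X)]big1.
      by rewrite GRing.addr0 GRing.subrr.
    by move=> t /negPf ->; exact: GRing.mul0r.
  by apply/ffunP => t; rewrite !ffunE /= GRing.subrK.
rewrite card_in_imset ?cardsX ?cardsT ?card_Fp //.
move=> [v k] [w l]; rewrite !inE /= !andbT => /eqP v0 /eqP w0 e.
have := congr1 (fun F : {ffun T -> 'F_p} => \sum_t F t) e; rewrite !fsum /= v0 w0 !GRing.add0r => kl.
rewrite kl in e *; congr (_, _); apply/ffunP => t.
by have /ffunP/(_ t) := e; rewrite !ffunE => /GRing.addIr.
Qed.

End ZeroSum.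

(** * Layers of GGS-groups *)

Section GGSLayers.
Set Implicit Arguments.
Unset Strict Implicit.
Local Open Scope group_scope.
Variable p : nat.
Hypothesis p_prime : prime p.
Implicit Types (f g h c : tree_aut p) (u v w : word p) (x y : 'I_p).
Notation S := (@sylow_S p).
Notation a := (@rot_a p).
Variables (b : tree_aut p) (x0 : 'I_p).
Hypotheses (bS : S b) (b1 : fix1 b) (bx0 : section b [:: x0] = b).
Hypothesis bx : forall x, x != x0 -> section b [:: x] = a ^+ (lab_exp b [:: x]).
Hypothesis level_sum_b_neq0 : level_sum 1 b <> 0%R.
Notation G := (ggs b).
Notation D := (derived_subgroup G).
Let GG := ggs_group b.
Let DG := ggs'_group b.
Let GS : G `<=` S := ggs_sylow bS.
Let Ga : G a := @ggs_a p b.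
Let Gb : G b := @ggs_b p b.
Let DsG := @ggs'_sub p b.

Lemma rotX_add1 (t : 'F_p) : a ^+ (t + 1)%R = a ^+ t * a.
Proof.
rewrite -expgSr [RHS](expg_modn _ (rotXp p_prime)) [LHS](expg_modn _ (rotXp p_prime)); congr (_ ^+ _).
by rewrite -!(val_Fp_nat p_prime) natr_Zp -GRing.natr1 natr_Zp.
Qed.

(* The conjugate of b by a power of a whose section at y is b. *)
Definition bconj y := b ^ (a ^+ (res y - res x0 : 'F_p)%R).

Lemma bconj_G y : G (bconj y).
Proof. exact: ggs_bJ. Qed.
Lemma bconj_fix1 y : fix1 (bconj y).
Proof. exact: fix1J. Qed.

Lemma bconj_sigma y : bconj (sigma p y) = bconj y ^ a.
Proof.
rewrite /bconj -conjgM -rotX_add1; congr (_ ^ (_ ^+ _)).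
have := res_sigmaX p_prime 1 y; rewrite expg1 => ->.
by rewrite GRing.addrAC.
Qed.

Lemma lab_exp_bconj_sigma x y : lab_exp (bconj (sigma p y)) [:: sigma p x] = lab_exp (bconj y) [:: x].
Proof.
rewrite bconj_sigma; have -> : [:: sigma p x] = a [:: x] by rewrite -[a]expg1 rotX_word expg1.
by rewrite lab_expJ ?bconj_fix1 //; [exact: (GS (bconj_G y))|exact: rot_sylow].
Qed.

(** Modulo D, the exponent of b in an element of G is its level-one sum divided by that of b. The
    formula says that h has the same first-level exponents as the product of the [bconj y], each
    raised to the exponent of b in the section of h at y. *)
Definition convolution h := forall x,
  (level_sum 1 b * lab_exp h [:: x] = \sum_(y < p) level_sum 1 (section h [:: y]) * lab_exp (bconj y) [:: x])%R.

Lemma convolutionM f h : S f -> S h -> fix1 f -> convolution f -> convolution h ->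
  convolution (f * h).
Proof.
move=> fS hS f1 cf ch x; rewrite lab_expM // f1 GRing.mulrDr cf ch -big_split /=.
apply: eq_bigr => y _; rewrite sectionM1 // -GRing.mulrDl; congr (_ * _)%R.
by rewrite -!/(level_sum 1 _) level_sumM //; exact: section_sylow.
Qed.

Lemma convolutionV f : S f -> fix1 f -> convolution f -> convolution f^-1.
Proof.
move=> fS f1 cf x; rewrite lab_expV // autV_fix // GRing.mulrN cf -GRing.sumrN.
apply: eq_bigr => y _; rewrite sectionV1 // -GRing.mulNr; congr (_ * _)%R.
by rewrite -!/(level_sum 1 _) level_sumV //; exact: section_sylow.
Qed.

Lemma convolutionJ f k : S f -> fix1 f -> convolution f -> convolution (f ^ (a ^+ k)).
Proof.
move=> fS f1 cf; elim: k => [|k IH]; first by rewrite conjg1.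
rewrite expgSr conjgM; move: (f ^ (a ^+ k)) (sylowJ fS (sylowX k (@rot_sylow p))) (fix1J (a ^+ k) f1) IH.
move=> {}f {}fS {}f1 {}cf x; have [x' ->] : exists x', x = sigma p x'.
  by exists ((sigma p)^-1 x); rewrite permKV.
have sa y : a [:: y] = [:: sigma p y] by rewrite -[a]expg1 rotX_word expg1.
rewrite -sa lab_expJ ?f1 //; last exact: rot_sylow.
rewrite cf [RHS](reindex_inj (@perm_inj _ (sigma p))) /=.
apply: eq_bigr => y _; rewrite lab_exp_bconj_sigma; congr (_ * _)%R.
by rewrite -sa sectionJ ?f1 // section_rot conjg1.
Qed.

Lemma bconj_x0 : bconj x0 = b.
Proof. by rewrite /bconj GRing.subrr conjg1. Qed.

Lemma convolution_b : convolution b.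
Proof.
move=> x; rewrite (bigD1 x0) // bx0 bconj_x0 big1; first exact/esym/GRing.addr0.
move=> y /bx ->; rewrite level_sumX ?level_sum_rot //; last exact: rot_sylow.
by rewrite GRing.mul0rn GRing.mul0r.
Qed.

(* Both sides are additive in h and equivariant under conjugation by a, so it
   suffices to compare them at b. *)
Lemma stab_convolution h : G h -> fix1 h -> convolution h.
Proof.
move=> Gh h1.
(* The factor a^i makes the claim stable under products and inverses over all of G; it is trivial
   when h fixes the first level. *)
suff [i [f [[Gf f1] cf e]]] : exists i f, [/\ G f /\ fix1 f, convolution f & h = a ^+ i * f].
  have fi : a ^+ i = 1.
    have : lab_exp (a ^+ i) [::] = 0%R.
      apply: (lab_exp_root0 p_prime (x := x0)); first exact/sylowX/rot_sylow.
      by rewrite -[RHS]h1 e tree_autME !rotX_word f1.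
    rewrite lab_exp_rotX // => /eqP; rewrite -(GRing.dvdn_pcharf (pchar_Fp p_prime)).
    by case/dvdnP => j ->; rewrite mulnC expgnA rotXp // expg1n.
  by rewrite e fi mul1g.
move: h Gh {h1}; apply: (@subgroup_gen_min p _ [set h | exists i f,
  [/\ G f /\ fix1 f, convolution f & h = a ^+ i * f]]); last first.
  move=> _ [->|->].
    exists 1%N, 1; split; [by split; [exact: subgroup1|]| |by rewrite mulg1].
    move=> x; rewrite lab_exp1 GRing.mulr0 big1 // => y _.
    by rewrite section1 level_sum1 // GRing.mul0r.
  by exists 0%N, b; split=> //; [exact: convolution_b|rewrite mul1g].
apply: subgroupP => /=.
- exists 0%N, 1; split; [by split; [exact: subgroup1|]| |by rewrite mulg1].
  move=> x; rewrite lab_exp1 GRing.mulr0 big1 // => y _.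
  by rewrite section1 level_sum1 // GRing.mul0r.
- move=> _ _ [i [f [[Gf f1] cf ->]]] [j [g [[Gg g1] cg ->]]].
  have GJ : G (f ^ (a ^+ j)) by exact: (subgroupJ GG Gf (ggs_aX j)).
  exists (i + j)%N, (f ^ (a ^+ j) * g); split.
  + by split; [exact: (subgroupM GG GJ Gg)|apply: fix1M => //; exact: fix1J].
  + apply: convolutionM => //; [exact: GS|exact: GS|exact: fix1J|].
    by apply: convolutionJ => //; exact: GS.
  + rewrite -[LHS]mulgA [f * _]mulgA (conjgC f) expgnDr -[RHS]mulgA; congr (_ * _).
    exact/esym/mulgA.
- move=> _ [i [f [[Gf f1] cf ->]]].
  have inv := expVg_period i (prime_gt0 p_prime) (rotXp p_prime).
  exists (i * p.-1)%N, (f^-1 ^ (a ^+ (i * p.-1))); split.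
  + by split; [exact: (subgroupJ GG (subgroupV GG Gf) (ggs_aX _))|apply/fix1J/fix1V].
  + by apply: convolutionJ; [exact/sylowV/GS|exact: fix1V|apply: convolutionV => //; exact: GS].
  + by rewrite invgM inv conjgC.
Qed.

(* By induction on d, all the moments of n vanish: the d-th moment of its      *)
(* convolution is level_sum 1 b times the d-th moment of n, plus lower moments.      *)
Lemma convolution_inj (n : 'I_p -> 'F_p) :
  (forall x, \sum_(y < p) n y * lab_exp (bconj y) [:: x] = 0)%R -> forall y, n y = 0%R.
Proof.
move=> cn.
have moment d : (\sum_(y < p) n y * res y ^+ d = 0)%R.
  elim/ltn_ind: d => d IH.
  have shift y : (\sum_(x < p) res x ^+ d * lab_exp (bconj y) [:: x] =
      \sum_(z < p) (res y + (res z - res x0)) ^+ d * lab_exp b [:: z])%R.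
    rewrite /bconj; set t := (res y - res x0 : 'F_p)%R.
    rewrite (reindex_perm (sigma p ^+ t)); apply: eq_bigr => z _.
    rewrite res_sigmaX // natr_Zp -rotX_word lab_expJ //; last exact/sylowX/rot_sylow.
    by rewrite /t GRing.addrCA.
  have : (\sum_(x < p) res x ^+ d * (\sum_(y < p) n y * lab_exp (bconj y) [:: x]) = 0)%R.
    by apply: big1 => x _; rewrite cn GRing.mulr0.
  under eq_bigr do rewrite GRing.mulr_sumr.
  rewrite exchange_big /=.
  under eq_bigr => y _ do (under eq_bigr do rewrite GRing.mulrCA; rewrite -GRing.mulr_sumr shift GRing.mulr_sumr).
  rewrite exchange_big /=.
  have inner z : (\sum_(y < p) n y * ((res y + (res z - res x0)) ^+ d * lab_exp b [:: z]) =
      (\sum_(y < p) n y * res y ^+ d) * lab_exp b [:: z])%R.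
    rewrite GRing.mulr_suml.
    under eq_bigr do rewrite GRing.exprDn GRing.mulrA.
    rewrite -!GRing.mulr_suml; congr (_ * _)%R.
    under eq_bigr do rewrite GRing.mulr_sumr.
    rewrite exchange_big big_ord_recl /= [X in (_ + X)%R]big1 ?GRing.addr0.
      by apply: eq_bigr => y _; rewrite subn0 GRing.expr0 GRing.mulr1 bin0 GRing.mulr1n.
    move=> i _; rewrite (eq_bigr (fun y => n y * res y ^+ (d - (lift ord0 i)) *
        ((res z - res x0) ^+ (lift ord0 i) *+ 'C(d, lift ord0 i)))%R); last first.
      by move=> y _; rewrite -GRing.mulrnAr GRing.mulrA.
    by rewrite -GRing.mulr_suml IH ?GRing.mul0r // rev_ord_proof.
  under eq_bigr do rewrite inner.
  rewrite -GRing.mulr_sumr => /eqP; rewrite GRing.mulf_eq0 => /orP[/eqP //|/eqP s0].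
  case: level_sum_b_neq0; rewrite -s0 /=.
  by apply: eq_bigr => x _; rewrite lab_exp_section cats0.
(* Vanishing moments make n orthogonal to every polynomial in the letter; a polynomial vanishing at
   all letters except y0 then isolates n y0. *)
have poly_sum (Q : {poly 'F_p}) : (\sum_(y < p) n y * Q.[res y] = 0)%R.
  under eq_bigr do rewrite horner_coef GRing.mulr_sumr.
  rewrite exchange_big big1 // => i _.
  by under eq_bigr do rewrite GRing.mulrCA; rewrite -GRing.mulr_sumr moment GRing.mulr0.
move=> y0; pose Q := (\prod_(y < p | y != y0) ('X - (res y)%:P))%R.
have Q0 y : y != y0 -> (Q.[res y] = 0)%R.
  by move=> yy0; rewrite horner_prod (bigD1 y) //= hornerXsubC GRing.subrr GRing.mul0r.
have := poly_sum Q; rewrite (bigD1 y0) //= [X in (_ + X)%R]big1 ?GRing.addr0; last first.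
  by move=> y /Q0 ->; rewrite GRing.mulr0.
move/eqP; rewrite GRing.mulf_eq0 => /orP[/eqP //|].
rewrite horner_prod => /GRing.prodf_eq0[y yy0].
by rewrite hornerXsubC GRing.subr_eq0 (inj_eq (res_inj p_prime)) eq_sym (negbTE yy0).
Qed.

(** By [convolution_inj] the convolution is injective on the finite set F_p^p, hence onto; suitable
    powers of the [bconj y] realise any vector. *)
Lemma first_level_onto (v : 'I_p -> 'F_p) :
  exists g, [/\ G g, fix1 g & forall x, lab_exp g [:: x] = v x].
Proof.
pose F (n : {ffun 'I_p -> 'F_p}) : {ffun 'I_p -> 'F_p} :=
  [ffun x => \sum_(y < p) n y * lab_exp (bconj y) [:: x]]%R.
have Finj : injective F.
  move=> n n' /ffunP e; apply/ffunP => y; apply/eqP; rewrite -GRing.subr_eq0; apply/eqP.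
  apply: (convolution_inj (n := fun y => (n y - n' y)%R)) => x.
  under eq_bigr do rewrite GRing.mulrBl.
  by rewrite GRing.sumrB; have := e x; rewrite !ffunE => ->; rewrite GRing.subrr.
have [F' _ FK] := injF_bij Finj.
have [n en] : exists n, F n = [ffun x => v x] by exists (F' [ffun x => v x]).
suff [g [Gg g1 gex]] : exists g, [/\ G g, fix1 g & forall x,
    lab_exp g [:: x] = (\sum_(y < p) n y * lab_exp (bconj y) [:: x])%R].
  by exists g; split=> // x; rewrite gex; have /ffunP/(_ x) := en; rewrite !ffunE.
elim: (index_enum _) => [|y r [g [Gg g1 gex]]].
  by exists 1; split=> [||x]; [exact: subgroup1| |rewrite lab_exp1 big_nil].
have GX : G (bconj y ^+ n y) by exact: (subgroupX (n y) GG (bconj_G y)).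
have X1 := fix1X (n y) (bconj_fix1 y).
exists (bconj y ^+ n y * g); split; [exact: (subgroupM GG GX Gg)|exact: fix1M|move=> x].
rewrite big_cons -gex (lab_expM p_prime _ (GS GX) (GS Gg)) X1.
rewrite lab_expX ?bconj_fix1 //; last exact: (GS (bconj_G y)).
by rewrite -GRing.mulr_natl natr_Zp.
Qed.

Definition same_coset f g := D (f^-1 * g).

Lemma same_coset_refl f : same_coset f f.
Proof. by rewrite /same_coset mulVg; apply: subgroup1. Qed.

Lemma same_coset_trans f g h : same_coset f g -> same_coset g h -> same_coset f h.
Proof.
move=> fg gh; have := subgroupM DG fg gh.
by rewrite -mulgA mulVKg.
Qed.

Lemma same_cosetM f g f' g' : G g -> same_coset f f' -> same_coset g g' ->
  same_coset (f * g) (f' * g').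
Proof.
move=> Gg ff gg; rewrite /same_coset.
have -> : (f * g)^-1 * (f' * g') = (f^-1 * f') ^ g * (g^-1 * g').
  by rewrite conjgE invgM -!mulgA mulVKg.
exact: (subgroupM DG (ggs'J ff Gg) gg).
Qed.

Lemma same_cosetC f g : G f -> G g -> same_coset (f * g) (g * f).
Proof.
move=> Gf Gg; rewrite /same_coset.
have -> : (f * g)^-1 * (g * f) = [~ g, f] by rewrite commgEl conjgE invgM -!mulgA.
exact: derivedR.
Qed.

Lemma same_cosetV f g : G g -> same_coset f g -> same_coset f^-1 g^-1.
Proof.
move=> Gg fg; rewrite /same_coset.
have -> : f^-1^-1 * g^-1 = ((f^-1 * g) ^ g^-1)^-1.
  by rewrite conjgE [g^-1^-1]invgK mulgK invgM.
exact: (subgroupV DG (ggs'J fg (subgroupV GG Gg))).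
Qed.

Lemma ggs_coset g : G g -> exists i k, same_coset (a ^+ i * b ^+ k) g.
Proof.
have GaX i : G (a ^+ i) := subgroupX i GG Ga.
have GbX i : G (b ^+ i) := subgroupX i GG Gb.
move=> Gg; suff : G g /\ exists i k, same_coset (a ^+ i * b ^+ k) g by case.
move: g Gg; apply: (@subgroup_gen_min p _ [set g | G g /\ exists i k, same_coset (a ^+ i * b ^+ k) g]).
  apply: subgroupP => /=.
  - split; first exact: subgroup1.
    by exists 0%N, 0%N; rewrite mulg1; exact: same_coset_refl.
  - move=> f h [Gf [i [k fe]]] [Gh [j [l he]]]; split; first exact: (subgroupM GG Gf Gh).
    exists (i + j)%N, (k + l)%N; apply: same_coset_trans (same_cosetM _ fe he).
      rewrite !expgnDr -!mulgA; apply: same_cosetM; [|exact: same_coset_refl|].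
        by apply: (subgroupM GG) => //; apply: (subgroupM GG).
      rewrite !mulgA; apply: same_cosetM; [exact: GbX| |exact: same_coset_refl].
      exact: same_cosetC.
    exact: (subgroupM GG).
  - move=> f [Gf [i [k fe]]]; split; first exact: (subgroupV GG Gf).
    exists (i * p.-1)%N, (k * p.-1)%N; apply: same_coset_trans (same_cosetV Gf fe).
    rewrite invgM (expVg_period _ (prime_gt0 p_prime) (rotXp p_prime)).
    rewrite (expVg_period _ (prime_gt0 p_prime) (bXp p_prime b1 bx0 bx)).
    exact: same_cosetC.
move=> _ [->|->]; split=> //.
  by exists 1%N, 0%N; rewrite mulg1 expg1; exact: same_coset_refl.
by exists 0%N, 1%N; rewrite mul1g expg1; exact: same_coset_refl.
Qed.

Lemma level_sum_derived n h : D h -> level_sum n h = 0%R.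
Proof.
pose K := [set h | S h /\ level_sum n h = 0%R].
move=> Dh; suff : K h by case.
move: h Dh; apply: derived_sub; last first.
  move=> f h /GS fS' /GS hS; split; last exact: level_sumR.
  by rewrite commgEl; apply: sylowM; [exact: sylowV|exact: sylowJ].
apply: subgroupP => [|f h [fS' f0] [hS h0]|f [fS' f0]]; split.
- by have := sylowX 0 bS.
- exact: level_sum1.
- exact: sylowM.
- by rewrite level_sumM // f0 h0 GRing.addr0.
- exact: sylowV.
- by rewrite level_sumV // f0 GRing.oppr0.
Qed.

(** G/D is generated by the images of a and b, on which the level sums 0 and 1 take the values (1,
    0) and (0, s) with s nonzero; as a^p = b^p = 1, these two sums detect D. *)
Lemma derived_mem g : G g -> level_sum 0 g = 0%R -> level_sum 1 g = 0%R -> D g.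
Proof.
move=> Gg l0 l1; have [i [k Dg]] := ggs_coset Gg.
have aS i' : S (a ^+ i') by apply/sylowX/rot_sylow.
have bkS k' : S (b ^+ k') by apply/sylowX.
have fS : S (a ^+ i * b ^+ k) by apply: sylowM.
have level_sumE n : level_sum n g = (level_sum n a *+ i + level_sum n b *+ k)%R.
  have := level_sum_derived n Dg; rewrite level_sumM //; [|exact: sylowV|exact: GS].
  rewrite level_sumV // level_sumM // !level_sumX //; last exact: rot_sylow.
  by move/eqP; rewrite GRing.addrC GRing.subr_eq0 => /eqP.
have i0 : a ^+ i = 1.
  have := level_sumE 0%N; rewrite l0 level_sum_rot // (level_sum_b p_prime bS b1 bx0 bx) GRing.mul0rn GRing.addr0.
  move/esym/eqP; rewrite -(GRing.dvdn_pcharf (pchar_Fp p_prime)) => /dvdnP[j ->].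
  by rewrite mulnC expgnA rotXp // expg1n.
have k0 : b ^+ k = 1.
  have := level_sumE 1%N; rewrite l1 level_sum_rot // GRing.mul0rn GRing.add0r -GRing.mulr_natr.
  move/esym/eqP; rewrite GRing.mulf_eq0 => /orP[/eqP //|].
  rewrite -(GRing.dvdn_pcharf (pchar_Fp p_prime)) => /dvdnP[j ->].
  by rewrite mulnC expgnA (bXp p_prime b1 bx0 bx) expg1n.
by have := Dg; rewrite /same_coset i0 k0 mulg1 invg1 mul1g.
Qed.

Lemma stab2_derived m g : level_stab G m.+2 g -> D g.
Proof.
move=> gm; have [Gg _] := gm; have gS := GS Gg.
apply: derived_mem => //; first exact: (stab_lab_exp0 p_prime gS gm).
by apply: big1 => x _; rewrite /= lab_exp_section cats0; exact: (stab_lab_exp0 p_prime gS gm).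
Qed.

Hypothesis G_self_similar : self_similar G.

(** The first-level exponents of g vanish, so inverting the convolution kills the level-one sums of
    its sections; their root exponents vanish as well, and [derived_mem] applies. *)
Lemma stab2_section_derived m g x : level_stab G m.+2 g -> D (section g [:: x]).
Proof.
move=> gm; have [Gg _] := gm; have gS := GS Gg.
have g1 : fix1 g by move=> y; exact: (level_stab_fix gm).
apply: derived_mem; first exact: G_self_similar.
  by rewrite /= lab_exp_section cats0; exact: (stab_lab_exp0 p_prime gS gm).
apply: (convolution_inj (n := fun y => level_sum 1 (section g [:: y]))) => y.
by rewrite -stab_convolution // (stab_lab_exp0 p_prime gS gm) // GRing.mulr0.
Qed.

Lemma tuple1E (u : 1.-tuple 'I_p) : exists x, u = [tuple x].
Proof. by case/tupleP: u => x u; exists x; rewrite (tuple0 u); apply: val_inj. Qed.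

Lemma sum_label_vector1 g : (\sum_(u : 1.-tuple 'I_p) label_vector 1 g u = level_sum 1 g)%R.
Proof.
rewrite (reindex (fun x : 'I_p => [tuple x])) /=.
  by apply: eq_bigr => x _; rewrite ffunE lab_exp_section cats0.
apply: onW_bij; exists (fun u : 1.-tuple 'I_p => thead u) => [x|u]; first exact: theadE.
by have [x ->] := tuple1E u; rewrite theadE.
Qed.

Lemma layer1_full : layer 1 G = finset.setT.
Proof.
apply/setP => v; rewrite [RHS]inE; apply/layerP.
have [g [Gg g1 gex]] := first_level_onto (fun x => v [tuple x]).
exists g; first exact: fix1_stab.
by apply/ffunP => u; rewrite ffunE; have [x ->] := tuple1E u; rewrite /= gex.
Qed.

Lemma card_layer1 : #|layer 1 G| = (p ^ p)%N.
Proof. by rewrite layer1_full cardsT card_ffun card_Fp // card_tuple card_ord expn1. Qed.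

(** Among elements of St_G(1), those of D are singled out by a zero sum of first-level exponents,
    and all exponent vectors occur in G: the layer is a hyperplane. *)
Lemma card_layer1_derived : #|layer 1 D| = (p ^ p.-1)%N.
Proof.
have [x _] := res_surj p_prime 0%R.
have := card_zero_sum [tuple x] p_prime; rewrite card_tuple card_ord expn1.
have -> : (p ^ p = p ^ p.-1 * p)%N by rewrite -expnSr prednK ?prime_gt0.
move/eqP; rewrite eqn_pmul2r ?prime_gt0 // => /eqP <-.
apply: eq_card => v; rewrite inE; apply/layerP/eqP => [[g [Dg _] <-]|v0].
  by rewrite sum_label_vector1 level_sum_derived.
have : v \in layer 1 G by rewrite layer1_full inE.
case/layerP => g g1 ev; exists g => //; have [Gg _] := g1.
split; last by case: g1.
apply: derived_mem => //; last by rewrite -sum_label_vector1 ev.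
exact: (stab_lab_exp0 p_prime (GS Gg) g1).
Qed.

Hypothesis branching : forall k : 'I_p -> tree_aut p, (forall x, D (k x)) ->
  exists2 g, level_stab G 1 g & psi g = k.

(** Sections of St_G(m+2) lie in St_D(m+1), and [branching] lifts every tuple from St_D(m+1)
    back. *)
Lemma card_layer_succ m : #|layer m.+2 G| = (#|layer m.+1 D| ^ p)%N.
Proof.
apply/eqP; rewrite eqn_leq; apply/andP; split.
  apply: card_layer_le => g x gm; split; first exact: stab2_section_derived gm.
  by have [] := section_level_stab x G_self_similar gm.
apply: card_layer_ge => k kD.
have [g [Gg g1] gk] := branching (fun x => (kD x).1).
have gk' x : section g [:: x] = k x by rewrite -gk.
exists g => //; split=> // -[|x u] // [um].
by rewrite -cat1s sectionE g1 // gk' (kD x).2.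
Qed.

Lemma layer_derived m : layer m.+2 D = layer m.+2 G.
Proof.
apply/setP => v; apply/layerP/layerP => -[g [Hg gm] <-]; exists g => //; split=> //.
  exact: DsG.
exact: (stab2_derived (m := m)).
Qed.

Lemma card_layer_ggs m : #|layer m.+2 G| = (p ^ (p.-1 * p ^ m.+1))%N.
Proof.
elim: m => [|m IH]; first by rewrite card_layer_succ card_layer1_derived -expnM.
by rewrite card_layer_succ layer_derived IH -expnM -mulnA -expnSr.
Qed.

End GGSLayers.

(** * From the defining vector of b to its sections and level sums *)

Section DirectedTuple.
Set Implicit Arguments.
Unset Strict Implicit.
Local Open Scope group_scope.
Variable p : nat.
Hypothesis p_prime : prime p.
Variables (b : tree_aut p) (e : 'rV['F_p]_p.-1).
Hypotheses (bS : sylow_S b) (b1 : fix1 b) (b_dir : psi b = directed_tuple 0 e b).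

Lemma last_letter_lt : (p.-1 < p)%N.
Proof. by rewrite prednK ?prime_gt0. Qed.

(** The letter p of the alphabet, where the section of b is b; it plays the role of [x0] above. *)
Definition last_letter : 'I_p := Ordinal last_letter_lt.

(** The vector e extended by 0 at the last letter, where b has trivial root label. *)
Let entry (k : nat) : 'F_p := if insub k is Some i then e ord0 i else 0%R.

Lemma psi_section x : section b [:: x] = if insub (val x) is Some i then rot_a ^+ (e ord0 i) else b.
Proof. by rewrite -[LHS]/(psi b x) b_dir /directed_tuple addn0 modn_small. Qed.

Lemma section_last : section b [:: last_letter] = b.
Proof. by rewrite psi_section insubF //= ltnn. Qed.

Lemma lab_exp_entry x : lab_exp b [:: x] = entry x.
Proof.
have -> : lab_exp b [:: x] = lab_exp (section b [:: x]) [::] by rewrite lab_exp_section cats0.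
rewrite psi_section /entry; case: insubP => [i _ _|_] /=.
  by rewrite lab_exp_rotX // natr_Zp.
exact: (lab_exp_root0 p_prime bS (b1 last_letter)).
Qed.

Lemma section_rot_power x : x != last_letter -> section b [:: x] = rot_a ^+ (lab_exp b [:: x]).
Proof.
move=> xl; rewrite lab_exp_entry psi_section /entry.
case: insubP => // /negP[]; rewrite ltn_neqAle -ltnS prednK ?prime_gt0 // ltn_ord andbT.
by apply: contra xl => /eqP xp; apply/eqP/val_inj.
Qed.

Lemma level_sum1_directed : level_sum 1 b = (\sum_(i < p.-1) e ord0 i)%R.
Proof.
rewrite /=; transitivity (\sum_(x < p) entry x)%R.
  by apply: eq_bigr => x _; rewrite lab_exp_section cats0 lab_exp_entry.
rewrite -(big_mkord xpredT entry).
have : forall q, q = p.-1.+1 -> (\sum_(0 <= k < q) entry k = \sum_(i < p.-1) e ord0 i)%R.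
  move=> q ->; rewrite big_nat_recr //= [entry p.-1]/entry insubF ?ltnn // GRing.addr0.
  by rewrite big_mkord; apply: eq_bigr => i _; rewrite /entry valK.
by apply; rewrite prednK ?prime_gt0.
Qed.

End DirectedTuple.

(** * Assembly of the chain, invariance and layer counts *)

Theorem theorem1p3 (p : nat) (p_prime : prime p) (p_odd : odd p)
    (G : set (tree_aut p)) (G_subgroup : is_subgroup G) (G_sub_S : G `<=` sylow_S)
    (G_semidirect : semidirect (subgroup_gen [set rot_a]) (level_stab G 1) G)
    (G_self_similar : self_similar G)
    (b : tree_aut p) (e : 'rV['F_p]_p.-1)
    (b_in_G : G b) (b_stab : level_stab sylow_S 1 b)
    (b_directed : psi b = directed_tuple 0 e b)
    (e_sum : (\sum_(i < p.-1) e ord0 i != 0)%R) :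
  exists N : nat -> nat -> set (tree_aut p),
    [/\ (forall m : nat, 0 < m ->
           let t := layer_length G m in
           [/\ gindex (level_stab G m) (level_stab G m.+1) = p ^ t,
               N m 0 = level_stab G m.+1,
               N m t = level_stab G m,
               forall j : nat, j < t ->
                 N m j `<` N m j.+1 /\ gindex (N m j.+1) (N m j) = p &
               forall H : set (tree_aut p),
                 (normal_in H G /\ level_stab G m.+1 `<=` H /\ H `<=` level_stab G m) <->
                 (exists2 j : nat, j <= t & H = N m j)]),
        (multi_EGS G ->
           (forall m j : nat, 0 < m -> j <= layer_length G m ->
              characteristic_in (N m j) G) /\
           (forall m : nat, 0 < m -> layer_length G m.+1 <= p * layer_length G m)) &
        (GGS_with G b -> regular_branch_over G (derived_subgroup G) ->
           layer_length G 1 = p /\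
           (forall m : nat, 2 <= m -> layer_length G m = p.-1 * p ^ m.-1))].
Proof.
have [bS b1'] := b_stab; have b1 : fix1 b := stab_fix1 b_stab.
have b_last := section_last p_prime b_directed.
have b_rot := section_rot_power bS b1 b_directed (p_prime := p_prime).
have level_sum_b_neq0 : level_sum 1 b <> 0%R by rewrite (level_sum1_directed p_prime bS b1 b_directed); exact/eqP.
have Ga : G rot_a by have [_ HG _ _ _] := G_semidirect; apply: HG; apply: sub_subgroup_gen.
pose c : tree_aut p := (rot_a * b)%g.
have Gc : G c by apply: subgroupM.
have co : odometer c := odometer_ab p_prime bS b1 b_last b_rot level_sum_b_neq0.
(* G contains a and b, so the elements found below w in the group they generate serve for G too. *)
have weakly_branch w : exists f, [/\ G f, f <> 1%g & supported f w].
  have [f [ggs_f f1 fw]] := ggs_weakly_branch p_prime p_odd bS b1 b_last b_rot level_sum_b_neq0 w.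
  exists f; split=> //; move: f ggs_f {f1 fw}; apply: subgroup_gen_min => //.
  by move=> _ [->|->].
have [N NP] := choice (layer_chain p_prime G_subgroup G_sub_S Gc co).
have card_l m : #|layer m G| = p ^ layer_length G m.
  by rewrite -(card_layer p_prime m G_subgroup G_sub_S); have [] := NP m.
exists N; split=> [m _|_|[e' [_ _ _ eG]] [_ _ _ _ branch]].
- exact: NP m.
- split=> [m j _ jt|m _].
    have [_ _ _ Nlt Nnorm] := NP m.
    apply: (characteristic_chain G_subgroup _ _ Nnorm jt) => [phi phia|i /Nlt[]//].
    by split; apply: (level_stab_image p_prime p_odd G_subgroup G_sub_S weakly_branch Gc co).
  (* The inequality of lengths is compared after exponentiation, as a bound of one layer by the p-th
     power of the layer above it in the tree. *)
  rewrite -(leq_exp2l _ _ (prime_gt1 p_prime)) -card_l mulnC expnM -card_l.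
  by apply: card_layer_le => g x; apply: section_level_stab.
have log_eq m k : #|layer m G| = p ^ k -> layer_length G m = k.
  by rewrite card_l => /eqP; rewrite eqn_exp2l ?prime_gt1 // => /eqP.
have eG' : G = ggs b := eG.
rewrite eG' in card_l log_eq G_self_similar branch *.
have branching (k : 'I_p -> tree_aut p) : (forall x, derived_subgroup (ggs b) (k x)) ->
    exists2 g, level_stab (ggs b) 1 g & psi g = k.
  by move=> /branch[g [g1 _] <-]; exists g.
split; first by apply: log_eq; apply: (card_layer1 p_prime (last_letter p_prime) bS b1 level_sum_b_neq0).
case=> [|[|m]] // _; apply: log_eq.
exact: (card_layer_ggs p_prime bS b1 b_last b_rot level_sum_b_neq0 G_self_similar branching).
Qed.
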